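(* Let $M$ be a connected smooth $2$-manifold and let $\boldsymbol{x}\colon M\to\mathbb{R}^3$ be a smooth immersion with Gaussian curvature function $K$, such that $M$ has no (nonempty) open subset on which $\operatorname{grad}K=0$. Suppose that $\boldsymbol{x}$ has strictly quasi-rotational Gauss map. Then $\boldsymbol{x}$ is locally congruent to a surface $\boldsymbol{p}_{k,c}$ for some nonzero real numbers $k,c$.
   Context: Quasi-rotational Gauss map: let $\boldsymbol{n}$ denote the Gauss map (unit normal field) of $\boldsymbol{x}$. The immersed surface $\boldsymbol{x}\colon M\to\mathbb{R}^3$ is said to have quasi-rotational Gauss map if there exist a straight line $l\subset\mathbb{R}^3$, a plane $P\subset\mathbb{R}^3$, a vector $\boldsymbol{v}$ parallel to $P$, and a $1$-parameter group $\{\phi_t\}$ of diffeomorphisms of $M$ such that, with a suitable choice of orientations of $l$ and $P$, (1) $l$ is orthogonal to $P$; (2) $\pi\circ\boldsymbol{x}\circ\phi_t=T_{t\boldsymbol{v}}\circ\pi\circ\boldsymbol{x}$; (3) $\boldsymbol{n}\circ\phi_t=\mathcal{R}_{\kappa t}\circ\boldsymbol{n}$ for some constant $\kappa$. Here $\pi\colon\mathbb{R}^3\to P$ is the orthogonal projection, $T_{t\boldsymbol{v}}$ is the parallel translation of $P$ by the vector $t\boldsymbol{v}$, and $\mathcal{R}_{\kappa t}$ is the rotation of $\mathbb{R}^3$ by angle $\kappa t$ with respect to the axis $l$ (acting on unit normal vectors through its linear part). The Gauss map is called parallel if these conditions hold with $\kappa=0$ (as is the case for cylindrical surfaces). Strictly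 quasi-rotational means quasi-rotational but not parallel. The surface $\boldsymbol{p}_{k,c}$: for nonzero real numbers $k,c$, $$\boldsymbol{p}_{k,c}(x,y)=\left(x,\ y,\ c\,e^{kx}\cos ky\right),\qquad (x,y)\in\mathbb{R}^2.$$ Locally congruent means: locally equal, up to reparametrization and a rigid motion of $\mathbb{R}^3$, to a piece of the indicated surface. *)

(* Defs.v *)
From mathcomp Require Import all_boot all_order all_algebra.
From mathcomp Require Import all_classical all_reals all_analysis.
Set Implicit Arguments.
Unset Strict Implicit.
Unset Printing Implicit Defensive.
Import Order.TTheory GRing.Theory Num.Theory.
Import numFieldNormedType.Exports.
Local Open Scope classical_set_scope.
Local Open Scope ring_scope.

(* V is meant to be finite-dimensional and U open: then C^(n+1) amounts to
   differentiability together with C^n directional derivatives. *)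
Fixpoint Ck (R : realType) (V W : normedModType R) (n : nat) (U : set V)
    (f : V -> W) : Prop :=
  if n is m.+1 then
    (forall p, U p -> differentiable f p) /\
    (forall v : V, Ck m U (fun p => 'D_v f p))
  else forall p, U p -> {for p, continuous f}.

Definition smooth_on (R : realType) (V W : normedModType R) (U : set V)
  (f : V -> W) : Prop := forall n : nat, Ck n U f.

(* [cfun] is only meaningful on [cdom], and [cinv] on [cimg]. *)
Record chart (R : realType) (M : topologicalType) := Chart {
  cdom : set M;
  cimg : set 'rV[R]_2;
  cfun : M -> 'rV[R]_2;
  cinv : 'rV[R]_2 -> M }.

Section Surfaces.
Context {R : realType} {M : topologicalType}.
Implicit Types (A : set (chart R M)) (c : chart R M).

Record is_chart c : Prop := IsChart {
  chart_open_dom : open (cdom c);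
  chart_open_img : open (cimg c);
  chart_fun : forall p, cdom c p -> cimg c (cfun c p);
  chart_inv : forall u, cimg c u -> cdom c (cinv c u);
  chart_funK : forall p, cdom c p -> cinv c (cfun c p) = p;
  chart_invK : forall u, cimg c u -> cfun c (cinv c u) = u;
  chart_fun_cont : forall p, cdom c p -> {for p, continuous (cfun c)};
  chart_inv_cont : forall u, cimg c u -> {for u, continuous (cinv c)} }.

Definition smooth_transition c c' : Prop :=
  smooth_on (cimg c `&` cinv c @^-1` cdom c') (cfun c' \o cinv c).

(* The charts of the maximal atlas generated by A, that is, the
   diffeomorphisms from an open subset of M onto an open subset of R^2. *)
Definition smooth_chart A c : Prop :=
  is_chart c /\
  (forall c', A c' -> smooth_transition c c' /\ smooth_transition c' c).

Definition smooth_surface A : Prop :=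
  [/\ hausdorff_space M, @second_countable M,
      (forall p, exists2 c, A c & cdom c p) &
      (forall c, A c -> smooth_chart A c)].

Definition smooth_map A (W : normedModType R) (f : M -> W) : Prop :=
  forall c, A c -> smooth_on (cimg c) (f \o cinv c).

Definition one_parameter_group A (phi : R -> M -> M) : Prop :=
  [/\ (forall p, phi 0 p = p),
      (forall s t p, phi (s + t) p = phi s (phi t p)),
      continuous (fun q : R^o * M => phi q.1 q.2) &
      (forall c c', A c -> A c' ->
         smooth_on
           [set q : R^o * 'rV[R]_2 |
              cimg c q.2 /\ cdom c' (phi q.1 (cinv c q.2))]
           (fun q => cfun c' (phi q.1 (cinv c q.2))))].

End Surfaces.

Section Euclidean.
Context {R : realType}.
Implicit Types (u v w q : 'rV[R]_3).

Definition dot n (u v : 'rV[R]_n) : R := \sum_(i < n) u 0 i * v 0 i.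

Definition vec3 (a b c : R) : 'rV[R]_3 := \row_(i < 3) [:: a; b; c]`_i.

Definition cross u v : 'rV[R]_3 :=
  let x (w : 'rV[R]_3) i := w 0 (inord i) in
  vec3 (x u 1%N * x v 2%N - x u 2%N * x v 1%N)
       (x u 2%N * x v 0%N - x u 0%N * x v 2%N)
       (x u 0%N * x v 1%N - x u 1%N * x v 0%N).

(* The unit vectors of lines and planes carry the orientations. *)
Record oriented_line := OrientedLine {
  line_point : 'rV[R]_3;
  line_dir : 'rV[R]_3;
  line_dir_unit : dot line_dir line_dir = 1 }.

Record oriented_plane := OrientedPlane {
  plane_point : 'rV[R]_3;
  plane_normal : 'rV[R]_3;
  plane_normal_unit : dot plane_normal plane_normal = 1 }.

Definition parallel_to_plane v (P : oriented_plane) : Prop :=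
  dot v (plane_normal P) = 0.

Definition orthogonal_line_plane (l : oriented_line) (P : oriented_plane) :
  Prop := forall w, parallel_to_plane w P -> dot (line_dir l) w = 0.

Definition plane_proj (P : oriented_plane) q : 'rV[R]_3 :=
  q - dot (q - plane_point P) (plane_normal P) *: plane_normal P.

(* Linear part of the rotation of angle theta about l (Rodrigues' formula);
   it depends on l only through its direction. *)
Definition rotation_linear (l : oriented_line) (theta : R) w : 'rV[R]_3 :=
  let e := line_dir l in
  cos theta *: w + sin theta *: cross e w + ((1 - cos theta) * dot e w) *: e.

Definition rigid_motion (g : 'rV[R]_3 -> 'rV[R]_3) : Prop :=
  exists (Q : 'M[R]_3) (b : 'rV[R]_3),
    [/\ Q *m Q^T = 1%:M, \det Q = 1 & forall q, g q = q *m Q + b].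

End Euclidean.
Arguments oriented_line : clear implicits.
Arguments oriented_plane : clear implicits.

Section Parametrized.
Context {R : realType}.
Implicit Types (X : 'rV[R]_2 -> 'rV[R]_3) (u : 'rV[R]_2).

Definition partial (W : normedModType R) (i : 'I_2) (f : 'rV[R]_2 -> W) :
  'rV[R]_2 -> W := fun u => 'D_(delta_mx 0 i) f u.

Definition first_form X u : 'M[R]_2 :=
  \matrix_(i, j) dot (partial i X u) (partial j X u).

Definition second_form X (nu : 'rV[R]_3) u : 'M[R]_2 :=
  \matrix_(i, j) dot (partial i (partial j X) u) nu.

(* Coordinates of the gradient of f for the metric induced by X. *)
Definition gradient X (f : 'rV[R]_2 -> R^o) u : 'rV[R]_2 :=
  (\row_i partial i f u) *m invmx (first_form X u).

End Parametrized.

Section Immersed.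
Context {R : realType} {M : topologicalType}.
Implicit Types (A : set (chart R M)) (x n : M -> 'rV[R]_3) (K : M -> R^o).

Definition immersion A x : Prop :=
  smooth_map A x /\
  (forall c u, A c -> cimg c u -> injective ('d (x \o cinv c) u)).

Definition gauss_map A x n : Prop :=
  [/\ smooth_map A n,
      (forall p, dot (n p) (n p) = 1) &
      (forall c u, A c -> cimg c u ->
         forall v, dot ('D_v (x \o cinv c) u) (n (cinv c u)) = 0)].

Definition gaussian_curvature A x n K : Prop :=
  forall c u, A c -> cimg c u ->
    K (cinv c u) = \det (second_form (x \o cinv c) (n (cinv c u)) u)
                   / \det (first_form (x \o cinv c) u).

Definition gradient_vanishes A x K (p : M) : Prop :=
  forall c, A c -> cdom c p ->
    gradient (x \o cinv c) (K \o cinv c) (cfun c p) = 0.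

Definition quasi_rotational A x n (l : oriented_line R) (P : oriented_plane R)
    (v : 'rV[R]_3) (phi : R -> M -> M) (kappa : R) : Prop :=
  [/\ parallel_to_plane v P, one_parameter_group A phi,
      orthogonal_line_plane l P,
      (forall t p,
         plane_proj P (x (phi t p)) = plane_proj P (x p) + t *: v) &
      (forall t p, n (phi t p) = rotation_linear l (kappa * t) (n p))].

(* "Parallel" is kappa = 0 for the data at hand.  It cannot mean that some
   data with kappa = 0 exist: the data v = 0, phi_t = id always do. *)
Definition strictly_quasi_rotational A x n : Prop :=
  exists (l : oriented_line R) (P : oriented_plane R) (v : 'rV[R]_3)
         (phi : R -> M -> M) (kappa : R),
    quasi_rotational A x n l P v phi kappa /\ kappa != 0.

Definition locally_congruent A x (S : 'rV[R]_2 -> 'rV[R]_3) : Prop :=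
  forall p : M, exists (c : chart R M) (g : 'rV[R]_3 -> 'rV[R]_3),
    [/\ smooth_chart A c, cdom c p, rigid_motion g &
        forall u, cimg c u -> x (cinv c u) = g (S u)].

End Immersed.

Definition p_surface (R : realType) (k c : R) (u : 'rV[R]_2) : 'rV[R]_3 :=
  let a := u 0 0 in let b := u 0 1 in
  vec3 a b (c * expR (k * a) * cos (k * b)).

(* Main.v *)
(* Let e direct the axis and put f2 = - v/|v|, f1 = f2 x e.  Where the Gauss
   map n is not horizontal, the surface is a graph z = f(a, b) over the plane
   with basis f1, f2, and following the flow shows that the gradient of f turns
   with constant speed along the lines a = const: with k = kappa/|v|,
   grad f (a, b + s) is grad f (a, b) rotated by the angle - k s.  Integrating
   f_b in b expresses f(a, b) through grad f (a, b0), and the rotated formula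
   for f_a is then compatible with it only if g = grad f (., b0) satisfies
   g' = k g.  Hence f = const + e^(k a) (A cos(k b) + B sin(k b)), which is a
   translate of e^(k a) cos(k b) unless f is constant.
   If n is horizontal on an open set, or vertical there, then the second
   fundamental form has rank at most 1 and K = 0, which is excluded; so f is not
   constant, and v <> 0 because v = 0 would make n vertical on an open set.
   Finally the formula for f gives 1 - n3^2 = D n3^2 e^(2 k a) with D locally
   constant where n3 <> 0.  For fixed D this is a closed condition that forces
   n3 <> 0, so by connectedness n3 vanishes nowhere. *)
From HB Require Import structures.
Require Import Defs.
From mathcomp Require Import all_boot all_order all_algebra.
From mathcomp Require Import all_classical all_reals all_analysis.
From mathcomp Require Import ring lra.
Import Order.TTheory GRing.Theory Num.Theory.
Import numFieldNormedType.Exports.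
Set Implicit Arguments.
Unset Strict Implicit.
Unset Printing Implicit Defensive.
Local Open Scope classical_set_scope.
Local Open Scope ring_scope.

(** * Functions of class C^n *)

Lemma near_in (T : topologicalType) (U : set T) p :
  open U -> U p -> \forall q \near p, U q.
Proof. by move=> oU Up; exact: open_nbhs_nbhs. Qed.

Section Differentiability.
Context {R : realType} {V W : normedModType R}.
Implicit Types (f g : V -> W) (x : V).

Lemma diff_near f x (e : R) : differentiable f x -> 0 < e ->
  \forall h \near 0, `|f (h + x) - f x - 'd f x h| <= e * `|h|.
Proof.
move=> /diff_locallyP[_ /eqaddoP fx] e0; have := fx _ e0.
by apply: filterS => h /=; rewrite !fctE opprD addrA.
Qed.

(** Epsilon form of the little-o expansion, converse to [diff_near]: a continuous linear map with
    small remainder must be the differential, by uniqueness. *)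
Lemma near_diff f x (df : {linear V -> W}) : continuous df ->
  (forall e : R, 0 < e ->
    \forall h \near 0, `|f (h + x) - f x - df h| <= e * `|h|) ->
  is_diff x f df.
Proof.
move=> dfc fx.
have fxo : f \o shift x = cst (f x) + df +o_ 0 id.
  apply/eqaddoP => e e0; have := fx _ e0.
  by apply: filterS => h /=; rewrite !fctE opprD addrA.
have dE := diff_unique dfc fxo.
split => //; apply/diff_locallyP; rewrite dE; split => //.
Qed.

Lemma near_eq_differentiable f g x :
  (\forall p \near x, f p = g p) -> differentiable f x -> differentiable g x.
Proof.
move=> fg df.
have fgx : f x = g x by exact: nbhs_singleton fg.
suff : is_diff x g ('d f x) by case.
apply: near_diff; first exact: diff_continuous.
move=> e e0; move: fg; rewrite (near_shift 0 x) subr0 => fg.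
near=> h; rewrite -fgx -(_ : f (h + x) = g (h + x)); last by near: h.
by near: h; exact: diff_near.
Unshelve. all: by end_near. Qed.

End Differentiability.

Section ContinuouslyDifferentiable.
Context {R : realType} {V : normedModType R}.

Section General.
Context {W : normedModType R}.
Implicit Types (U : set V) (f g : V -> W).

Lemma CkW n U f : Ck n.+1 U f -> Ck n U f.
Proof.
elim: n U f => [|n IH] U f [df Df] /=.
  by move=> p Up; exact/differentiable_continuous/df.
by split => // v; exact/IH/Df.
Qed.

Lemma Ck_continuous n U f : Ck n U f -> forall p, U p -> {for p, continuous f}.
Proof. by elim: n => [//|n IH] /CkW. Qed.

Lemma Ck_subset n U U' f : U' `<=` U -> Ck n U f -> Ck n U' f.
Proof.
move=> sU; elim: n f => [|n IH] f /=; first by move=> cf p /sU /cf.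
by case=> df Df; split=> [p /sU /df //|v]; exact/IH/Df.
Qed.

(** Openness of U turns agreement on U into agreement near each of its points, so the derivatives
    agree as well and the induction goes through. *)
Lemma Ck_eq n U f g : open U -> {in U, f =1 g} -> Ck n U f -> Ck n U g.
Proof.
move=> oU; elim: n f g => [|n IH] f g fg /=.
- move=> cf p Up.
  have fgp : \forall q \near p, f q = g q.
    near=> q; apply: fg; rewrite inE; near: q; exact: near_in.
  have cfp : f q @[q --> p] --> g p.
    by rewrite -(nbhs_singleton fgp); exact: cf.
  by apply: cvg_trans cfp; exact: near_eq_cvg.
- have nfg p : U p -> \forall q \near p, f q = g q.
    move=> Up; near=> q; apply: fg; rewrite inE; near: q; exact: near_in.
  move=> [df Df]; split=> [p Up|v].
    by apply: near_eq_differentiable (df p Up); exact: nfg.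
  apply: IH (Df v) => p; rewrite inE => Up.
  by apply: near_eq_derive; exact: nfg.
Unshelve. all: by end_near. Qed.

Lemma Ck_cst n U (a : W) : Ck n U (fun=> a).
Proof.
elim: n a => [|n IH] a /=; first by move=> p _; exact: cvg_cst.
split=> [p _|v]; first exact: differentiable_cst.
rewrite [X in Ck _ _ X](_ : _ = fun=> 0); first exact: IH.
by apply/funext => p; rewrite derive_cst.
Qed.

Lemma CkD n U f g : open U -> Ck n U f -> Ck n U g -> Ck n U (f \+ g).
Proof.
move=> oU; elim: n f g => [|n IH] f g /=.
  by move=> cf cg p Up; apply: continuousD; [exact: cf|exact: cg].
move=> [df Df] [dg Dg]; split=> [p Up|v].
  by apply: differentiableD; [exact: df|exact: dg].
apply: (Ck_eq oU _ (IH _ _ (Df v) (Dg v))) => p; rewrite inE => Up.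
by rewrite deriveD //; apply: diff_derivable; [exact: df|exact: dg].
Qed.

Lemma Ck_sum n U (I : Type) (r : seq I) (P : pred I) (F : I -> V -> W) :
  open U -> (forall i, P i -> Ck n U (F i)) ->
  Ck n U (fun p => \sum_(i <- r | P i) F i p).
Proof.
move=> oU hF; elim: r => [|i r IH].
  by apply: (Ck_eq oU _ (Ck_cst n U 0)) => p _; rewrite big_nil.
case Pi: (P i); last by apply: (Ck_eq oU _ IH) => p _; rewrite big_cons Pi.
apply: (Ck_eq oU _ (CkD oU (hF i Pi) IH)) => p _.
by rewrite big_cons Pi.
Qed.

End General.

(** The directional derivative of [L \o f] is [L] applied to that of [f], so the claim reproduces
    itself one order lower. *)
Lemma Ck_linear (W W' : normedModType R) n (U : set V) (L : {linear W -> W'})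
    (f : V -> W) :
  open U -> continuous L -> Ck n U f -> Ck n U (L \o f).
Proof.
move=> oU cL; elim: n f => [|n IH] f /=.
  by move=> cf p Up; apply: continuous_comp; [exact: cf|exact: cL].
move=> [df Df]; split=> [p Up|v].
  by apply: differentiable_comp; [exact: df|exact: linear_differentiable].
have CD := IH _ (Df v).
apply: (Ck_eq oU _ CD) => p; rewrite inE => Up.
rewrite deriveE; last first.
  by apply: differentiable_comp; [exact: df|exact: linear_differentiable].
rewrite diff_comp; [|exact: df|exact: linear_differentiable].
by rewrite diff_lin //= deriveE //; exact: df.
Qed.

Implicit Types (U : set V) (f g : V -> R).

Lemma CkM n U f g : open U -> Ck n U f -> Ck n U g -> Ck n U (f \* g).
Proof.
move=> oU; elim: n f g => [|n IH] f g.
  by move=> cf cg p Up; apply: continuousM; [exact: cf|exact: cg].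
move=> /[dup] /CkW Cf [df Df] /[dup] /CkW Cg [dg Dg]; split=> [p Up|v].
  by apply: differentiableM; [exact: df|exact: dg].
have CD : Ck n U ((f \* (fun p => 'D_v g p)) \+ (g \* (fun p => 'D_v f p))).
  by apply: CkD => //; apply: IH => //; [exact: Dg|exact: Df].
apply: (Ck_eq oU _ CD) => p; rewrite inE => Up.
by rewrite deriveM //; apply: diff_derivable; [exact: df|exact: dg].
Qed.

Lemma Ck_prod n U (I : Type) (r : seq I) (P : pred I) (F : I -> V -> R) :
  open U -> (forall i, P i -> Ck n U (F i)) ->
  Ck n U (fun p => \prod_(i <- r | P i) F i p).
Proof.
move=> oU hF; elim: r => [|i r IH].
  have C1 : Ck n U (fun=> 1 : R) by exact: Ck_cst.
  by apply: (Ck_eq oU _ C1) => p _; rewrite big_nil.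
case Pi: (P i); last by apply: (Ck_eq oU _ IH) => p _; rewrite big_cons Pi.
apply: (Ck_eq oU _ (CkM oU (hF i Pi) IH)) => p _.
by rewrite big_cons Pi.
Qed.

(** The derivative of 1/f is - (1/f)(1/f) D_v f: it involves 1/f only to one order less, so
    induction and [CkM] apply. *)
Lemma CkV n U f : open U -> (forall p, U p -> f p != 0) -> Ck n U f ->
  Ck n U (fun p => (f p)^-1).
Proof.
move=> oU f0; elim: n => [|n IH].
  by move=> cf p Up; apply: continuousV; [exact: f0|exact: cf].
move=> /[dup] /CkW Cf [df Df]; split=> [p Up|v].
  by apply: differentiableV; [exact: df|exact: f0].
have CD : Ck n U ((fun=> - 1) \* ((fun p => (f p)^-1) \* (fun p => (f p)^-1))
   \* (fun p => 'D_v f p)).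
  apply: CkM => //; last exact: Df.
  by apply: CkM => //; [exact: Ck_cst|apply: CkM => //; exact: IH].
apply: (Ck_eq oU _ CD) => p; rewrite inE => Up.
rewrite deriveV; [|exact: f0|by apply: diff_derivable; exact: df].
by rewrite /= mulN1r -invfM -expr2.
Qed.

End ContinuouslyDifferentiable.

Lemma Ck_id (R : realType) (V : normedModType R) n (U : set V) : Ck n U id.
Proof.
case: n => [|n]; first by move=> p _; exact: cvg_id.
split=> [p _|v]; first exact: (@ex_diff _ _ _ _ _ id id).
rewrite (_ : 'D_v id = fun=> v); first exact: Ck_cst.
by apply/funext => p; rewrite derive_id.
Qed.

(** * Matrix-valued maps: entries, chain rule, products and inverses *)

Section MatrixValued.
Context {R : realType} {V : normedModType R}.
Implicit Types (U : set V).

Lemma Ck_coord k U m n (f : V -> 'M[R]_(m, n)) i j : open U ->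
  Ck k U f -> Ck k U (fun p => f p i j).
Proof.
move=> oU.
have L_lin : linear (fun N : 'M[R]_(m, n) => N i j : R).
  by move=> a u v; rewrite !mxE.
pose L : {linear 'M[R]_(m, n) -> R} :=
  HB.pack (fun N : 'M[R]_(m, n) => N i j : R)
    (GRing.isLinear.Build R 'M[R]_(m, n) R *%R _ L_lin).
by apply: (@Ck_linear _ _ _ _ _ _ L) => //; exact: coord_continuous.
Qed.

Lemma Ck_mx k U m n (f : V -> 'M[R]_(m, n)) : open U ->
  (forall i j, Ck k U (fun p => f p i j)) -> Ck k U f.
Proof.
move=> oU Cf.
rewrite (_ : f = fun p => \sum_i \sum_j f p i j *: delta_mx i j); last first.
  by apply/funext => p; exact: matrix_sum_delta.
apply: Ck_sum => // i _; apply: Ck_sum => // j _.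
pose L : {linear R -> 'M[R]_(m, n)} :=
  HB.pack ( *:%R ^~ (delta_mx i j))
    (GRing.isLinear.Build R R 'M[R]_(m, n) *:%R ( *:%R ^~ (delta_mx i j))
      (fun a u v => etrans (scalerDl _ _ _)
         (congr1 (+%R ^~ _) (esym (scalerA _ _ _))))).
apply: (@Ck_linear _ _ _ _ _ _ L) => //; exact: scalel_continuous.
Qed.

Lemma diff_rV_sum m (W : normedModType R) (f : 'rV[R]_m -> W) p w :
  differentiable f p -> 'd f p w = \sum_i w 0 i *: 'D_(delta_mx 0 i) f p.
Proof.
move=> df; rewrite {1}(row_sum_delta w) linear_sum; apply: eq_bigr => i _.
by rewrite linearZ deriveE.
Qed.

(** By the chain rule D_v (f o g) is the sum of the products D_v g_i (D_i f o g), each factor being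
    one order lower. Scalar values of [f] make these products instances of [CkM]. *)
Lemma Ck_comp_scalar k U m (U' : set 'rV[R]_m) (f : 'rV[R]_m -> R)
    (g : V -> 'rV[R]_m) : open U -> (forall p, U p -> U' (g p)) ->
  Ck k U' f -> Ck k U g -> Ck k U (f \o g).
Proof.
move=> oU gU; elim: k f => [|k IH] f.
  move=> cf cg p Up; apply: continuous_comp; first exact: cg.
  by apply: cf; exact: gU.
move=> [df Df] /[dup] /CkW Cg [dg Dg]; split=> [p Up|v].
  by apply: differentiable_comp; [exact: dg|exact/df/gU].
have CD : Ck k U (fun p => \sum_i
    ((fun q => 'D_v g q 0 i) \* ('D_(delta_mx 0 i) f \o g)) p).
  apply: Ck_sum => // i _; apply: CkM => //; last by apply: IH => //; exact: Df.
  by apply: Ck_coord => //; exact: Dg.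
apply: (Ck_eq oU _ CD) => p; rewrite inE => Up /=.
have dgp := dg p Up; have dfp := df _ (gU p Up).
rewrite [RHS]deriveE; last exact: differentiable_comp.
by rewrite [in RHS]diff_comp //= (diff_rV_sum _ dfp) (deriveE _ dgp).
Qed.

Lemma Ck_mulmx k U m n p (f : V -> 'M[R]_(m, n)) (g : V -> 'M[R]_(n, p)) :
  open U -> Ck k U f -> Ck k U g -> Ck k U (fun q => f q *m g q).
Proof.
move=> oU Cf Cg; apply: Ck_mx => // i j.
have CS : Ck k U (fun q => \sum_l ((fun q => f q i l) \* (fun q => g q l j)) q).
  by apply: Ck_sum => // l _; apply: CkM => //; exact: Ck_coord.
by apply: (Ck_eq oU _ CS) => q _; rewrite mxE.
Qed.

Lemma Ck_det k U n (A : V -> 'M[R]_n) : open U ->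
  Ck k U A -> Ck k U (fun p => \det (A p)).
Proof.
move=> oU CA; apply: Ck_sum => // s _.
apply: CkM => //; first exact: Ck_cst.
by apply: Ck_prod => // i _; exact: Ck_coord.
Qed.

(** Cramer's formula: each entry is a cofactor divided by the determinant, both polynomial in the
    entries of [A]. *)
Lemma Ck_invmx k U n (A : V -> 'M[R]_n) : open U ->
  (forall p, U p -> A p \in unitmx) -> Ck k U A ->
  Ck k U (fun p => invmx (A p)).
Proof.
move=> oU uA CA; apply: Ck_mx => // i j.
have CD : Ck k U ((fun p => (\det (A p))^-1) \* (fun p => cofactor (A p) j i)).
  apply: CkM => //.
    apply: CkV => //; last exact: Ck_det.
    by move=> p /uA; rewrite unitmxE unitfE.
  apply: CkM => //; first exact: Ck_cst.
  apply: Ck_det => //; apply: Ck_mx => // a b.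
  have := Ck_coord (lift j a) (lift i b) oU CA.
  by apply: Ck_eq => // p _; rewrite !mxE.
apply: (Ck_eq oU _ CD) => p; rewrite inE => Up.
by rewrite /invmx uA //= !mxE.
Qed.

End MatrixValued.

Lemma Ck_comp (R : realType) (V : normedModType R) k (U : set V) m
    (U' : set 'rV[R]_m) n1 n2 (f : 'rV[R]_m -> 'M[R]_(n1, n2))
    (g : V -> 'rV[R]_m) :
  open U -> open U' -> (forall p, U p -> U' (g p)) ->
  Ck k U' f -> Ck k U g -> Ck k U (f \o g).
Proof.
move=> oU oU' gU Cf Cg; apply: Ck_mx => // i j.
apply: (Ck_comp_scalar (U' := U') (f := fun q => f q i j)) => //.
exact: Ck_coord.
Qed.

(** * Norm bounds for matrices and the mean value inequality *)

Section MeanValue.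
Context {R : realType}.

Lemma mx_norm_le m n (A : 'M[R]_(m, n)) (e : R) : 0 <= e ->
  (forall i j, `|A i j| <= e) -> `|A| <= e.
Proof.
move=> e0 Ae; rewrite [leLHS]/Num.Def.normr/= mx_normrE.
by apply: bigmax_le => // -[i j] _; exact: Ae.
Qed.

Lemma ler_mx_norm m n (A : 'M[R]_(m, n)) i j : `|A i j| <= `|A|.
Proof.
rewrite [leRHS]/Num.Def.normr/= mx_normrE.
exact: (le_bigmax _ (fun ij => `|A ij.1 ij.2|) (i, j)).
Qed.

Lemma mulmx_norm_le m n (w : 'rV[R]_m) (B : 'M[R]_(m, n)) (e : R) : 0 <= e ->
  (forall i j, `|B i j| <= e) -> `|w *m B| <= m%:R * e * `|w|.
Proof.
move=> e0 Be; apply: mx_norm_le => [|i j]; first by rewrite !mulr_ge0.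
rewrite mxE (le_trans (ler_norm_sum _ _ _))//.
rewrite (_ : m%:R * e * _ = \sum_(k < m) (`|w| * e)); last first.
  by rewrite sumr_const card_ord -mulr_natl; ring.
apply: ler_sum => k _.
by rewrite normrM ler_pM// ord1 ler_mx_norm.
Qed.

Lemma is_derive_line (V W : normedModType R) (F : V -> W) (p w : V) (s : R) :
  derivable F (p + s *: w) w ->
  is_derive s (1 : R) (fun t : R => F (p + t *: w)) ('D_w F (p + s *: w)).
Proof.
have E : (fun h : R => h^-1 *:
       (((fun t : R => F (p + t *: w)) \o shift s) (h *: 1) - F (p + s *: w))) =
     (fun h : R => h^-1 *:
       ((F \o shift (p + s *: w)) (h *: w) - F (p + s *: w))).
  apply/funext => h /=; congr (_ *: (F _ - _)).
  by rewrite [h%:A]mulr1 scalerDl addrCA.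
by move=> dF; split; rewrite /derivable/derive /= E.
Qed.

(** The mean value theorem is applied to each entry along the segment from u' to u, which stays in
    the ball by convexity. The norm being the maximum over the entries, no dimensional factor
    appears. *)
Lemma lipschitz_ball (V : normedModType R) m n (F : V -> 'M[R]_(m, n)) u0
    (r q : R) :
  0 <= q ->
  (forall u, ball u0 r u -> differentiable F u) ->
  (forall u w, ball u0 r u -> `|'D_w F u| <= q * `|w|) ->
  forall u u', ball u0 r u -> ball u0 r u' -> `|F u - F u'| <= q * `|u - u'|.
Proof.
move=> q0 dF Fq u u' Bu Bu'.
apply: mx_norm_le => [|i j]; first by rewrite mulr_ge0.
set w := u - u'.
have Bs (s : R) : s \in `[0, 1]%R -> ball u0 r (u' + s *: w).
  rewrite in_itv /= => /andP[s0 s1].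
  move: Bu Bu'; rewrite -ball_normE /= => Bu Bu'.
  rewrite (_ : u0 - _ = s *: (u0 - u) + (1 - s) *: (u0 - u')); last first.
    rewrite scalerBl scale1r addrCA -scalerBr opprB [_ - u + _]addrC subrKA.
    by rewrite -(opprB u u') scalerN opprD addrA.
  rewrite (le_lt_trans (ler_normD _ _))// !normrZ !ger0_norm ?subr_ge0//.
  (* At s = 0 the term in u vanishes and the strict inequality has to come from u' instead. *)
  have [->|s0'] := eqVneq s 0; first by rewrite mul0r subr0 mul1r add0r.
  have sr : s * `|u0 - u| < s * r by rewrite ltr_pM2l// lt_def s0'.
  have : (1 - s) * `|u0 - u'| <= (1 - s) * r.
    by rewrite ler_wpM2l ?subr_ge0// ltW.
  by move: sr; set a := `|_|; set b := `|_|; lra.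
pose g (s : R) : R := F (u' + s *: w) i j.
pose dg (s : R) : R := 'D_w F (u' + s *: w) i j.
have gdg (s : R) : s \in `[0, 1]%R -> is_derive s (1 : R) g (dg s).
  move=> s01; have := dF _ (Bs s s01) => /diff_derivable dFs.
  have [dFw DFw] := is_derive_line (dFs w).
  split; first by move/derivable_mxP : dFw; apply.
  by rewrite /dg -DFw derive_mx// mxE.
have gc : {within `[0, 1], continuous g}.
  by apply: derivable_within_continuous => s /gdg[].
have g01 (s : R) : s \in `]0, 1[%R -> is_derive s (1 : R) g (dg s).
  by move=> s01; apply: gdg; exact: subset_itv_oo_cc s01.
have [c c01] := MVT ltr01 g01 gc.
rewrite /g /dg scale0r addr0 scale1r /w subrKC subr0 mulr1 => FE.
rewrite !mxE FE (le_trans (ler_mx_norm _ _ _))//.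
by apply: Fq; apply: Bs; exact: subset_itv_oo_cc c01.
Qed.

End MeanValue.

(** * The inverse function theorem *)

Lemma unitmx_inj (F : fieldType) n (B : 'M[F]_n) :
  (forall w : 'rV[F]_n, w *m B = 0 -> w = 0) -> B \in unitmx.
Proof.
move=> B0; rewrite -row_free_unit -kermx_eq0; apply/eqP/row_matrixP => i.
by rewrite row0; apply: B0; rewrite -row_mul mulmx_ker row0.
Qed.

Section InverseFunction.
Context {R : realType}.

(** Completeness of row vectors, required by the Banach fixed point theorem. *)
HB.instance Definition _ n :=
  Uniform_isComplete.Build (matrix R 1 n) (@cauchy_cvg _).

Lemma mulmxr_cont m n p (A : 'M[R]_(n, p)) :
  continuous (mulmxr A : 'M[R]_(m, n) -> 'M[R]_(m, p)).
Proof.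
move=> B; have : Ck 0 setT (fun C : 'M[R]_(m, n) => C *m A).
  apply: Ck_mulmx; [exact: openT|exact: Ck_id|exact: Ck_cst].
by apply.
Qed.

Lemma jacobian_entry n (G : 'rV[R]_n -> 'rV[R]_n) u i j :
  differentiable G u -> jacobian G u i j = 'D_(delta_mx 0 i) G u 0 j.
Proof. by move=> dG; rewrite deriveEjacobian// -rowE [in RHS]mxE. Qed.

Lemma Ck_jacobian k n (U : set 'rV[R]_n) (G : 'rV[R]_n -> 'rV[R]_n) : open U ->
  Ck k.+1 U G -> Ck k U (jacobian G).
Proof.
move=> oU [dG DG]; apply: Ck_mx => // i j.
have CD := Ck_coord 0 j oU (DG (delta_mx 0 i)).
apply: (Ck_eq oU _ CD) => u; rewrite inE => Uu.
by rewrite jacobian_entry//; exact: dG.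
Qed.

Section LocalInverse.
Context {n : nat} (U : set 'rV[R]_n) (G : 'rV[R]_n -> 'rV[R]_n) (u0 : 'rV[R]_n).
Hypotheses (oU : open U) (Uu0 : U u0) (sG : smooth_on U G)
  (uJ : jacobian G u0 \in unitmx).

Let A := invmx (jacobian G u0).
(** A matrix with entries at most [e] shrinks row vectors by the factor n e <= 1/2; [n.+1] keeps the
    denominator nonzero when n = 0. *)
Let e : R := (2 * n.+1%:R)^-1.
Let e0 : 0 < e. Proof. by rewrite invr_gt0 mulr_gt0. Qed.

Let dG u : U u -> differentiable G u. Proof. by case: (sG 1) => + _; apply. Qed.

Lemma near_jacobian : \forall u \near u0,
  forall i j, `|(1%:M - jacobian G u *m A) i j| <= e.
Proof.
have C0 : Ck 0 U (fun u => jacobian G u *m A).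
  have CJ := Ck_jacobian oU (sG 1).
  exact: (Ck_mulmx oU CJ (Ck_cst 0 U A)).
have : jacobian G u *m A @[u --> u0] --> (1%:M : 'M[R]_n).
  by rewrite -(mulmxV uJ); exact: C0.
move=> /cvgrPdist_le /(_ _ e0); apply: filterS => u ue i j.
exact: le_trans (ler_mx_norm _ _ _) ue.
Qed.

(* [u] is a fixed point of [Phi z] exactly when [G u = z]. *)
Let Phi z u := u - (G u - z) *m A.

Let half (B : 'M[R]_n) : (forall i j, `|B i j| <= e) ->
  forall w : 'rV[R]_n, `|w *m B| <= 2^-1 * `|w|.
Proof.
move=> Be w; apply: le_trans (mulmx_norm_le w (ltW e0) Be) _.
rewrite ler_wpM2r// /e invfM mulrCA ler_piMr ?invr_ge0//.
by rewrite ler_pdivrMr// mul1r ler_nat.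
Qed.

(** The derivative of [Phi z] is 1 - J(u) A whatever z is. It vanishes at u0 and is small nearby, so
    one radius serves all z. *)
Lemma local_contraction : exists2 r : R, 0 < r &
  [/\ ball u0 r `<=` U,
      (forall u, ball u0 r u -> jacobian G u \in unitmx) &
      (forall z u u', ball u0 r u -> ball u0 r u' ->
        `|Phi z u - Phi z u'| <= 2^-1 * `|u - u'|)].
Proof.
have : nbhs u0
    (U `&` [set u | forall i j, `|(1%:M - jacobian G u *m A) i j| <= e]).
  by apply: filterI; [exact: open_nbhs_nbhs|exact: near_jacobian].
move=> /nbhs_ballP[r /= r0 rU].
exists r; first exact: r0.
split.
- by move=> u /rU[].
(* If w J(u) = 0 then w = w (1 - J(u) A) has norm at most |w|/2, hence w = 0. *)
- move=> u /rU[Uu Ju]; apply: unitmx_inj => w wJ.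
  have := half Ju w; rewrite mulmxBr mulmx1 mulmxA wJ mul0mx subr0.
  rewrite -subr_ge0 -{2}[`|w|]mul1r -mulrBl => w0.
  by apply/eqP; rewrite -normr_eq0; have := normr_ge0 w; move: w0; lra.
move=> z u u' Bu Bu'.
have [dPhi DPhi] : (forall u, ball u0 r u -> differentiable (Phi z) u) /\
    (forall u w, ball u0 r u -> 'D_w (Phi z) u = w *m (1%:M - jacobian G u *m A)).
  have dL x : is_diff x (mulmxr A : 'rV[R]_n -> 'rV[R]_n) (mulmxr A).
    by split; [exact/linear_differentiable/mulmxr_cont|
               rewrite diff_lin//; exact: mulmxr_cont].
  have dPhi u1 : ball u0 r u1 ->
      is_diff u1 (Phi z) (fun w => w - ('d G u1 w) *m A).
    move=> /rU[Uu1 _].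
    pose L : 'rV[R]_n -> 'rV[R]_n := 'd G u1.
    have GL : is_diff u1 G L by exact/differentiableP/dG.
    have dGz : is_diff u1 (G - cst z) (L - 0) by exact: is_diffB.
    have dLG := is_diff_comp dGz (dL ((G - cst z) u1)).
    have dI : is_diff u1 (id : 'rV[R]_n -> _) id by exact: is_diff_id.
    by apply: is_diff_eq (is_diffB dI dLG) _; rewrite subr0.
  split=> [u1 /dPhi[]//|u1 w /[dup] Bu1 /dPhi[dP dPE]].
  by rewrite deriveE// dPE -(mul_rV_lin1 'd G u1) mulmxBr mulmx1 mulmxA.
apply: (lipschitz_ball _ dPhi) => // u1 w Bu1.
rewrite DPhi//; apply: half; by have [_] := rU _ Bu1.
Qed.

Theorem inverse_function :
  exists (W : set 'rV[R]_n) (psi : 'rV[R]_n -> 'rV[R]_n),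
    [/\ open W, W u0, W `<=` U & open (G @` W)] /\
    (forall u, W u -> psi (G u) = u) /\ smooth_on (G @` W) psi.
Proof.
have [r r0 [rU Ju Phi_lip]] := local_contraction.
have uA : A \in unitmx by rewrite unitmx_inv.
pose W := ball u0 r.
pose a : R := n%:R * `|A|.
have a0 : 0 <= a by rewrite mulr_ge0.
have Aa (w : 'rV[R]_n) : `|w *m A| <= a * `|w|.
  by apply: mulmx_norm_le => // i j; exact: ler_mx_norm.
(* From u - u' = (Phi u - Phi u') + (G u - G u') A, where the first term is at most |u - u'|/2. *)
have G_lip u u' : W u -> W u' -> `|u - u'| <= (2 * a) * `|G u - G u'|.
  move=> Wu Wu'; have := Phi_lip 0 u u' Wu Wu'.
  rewrite /Phi !subr0 opprD addrACA -opprD -mulmxBl.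
  move=> PL; have := Aa (G u - G u').
  have := ler_distD ((G u - G u') *m A) (u - u') 0.
  by rewrite !subr0; move: PL; lra.
have G_inj u u' : W u -> W u' -> G u = G u' -> u = u'.
  move=> Wu Wu' GE; have := G_lip _ _ Wu Wu'.
  by rewrite GE subrr normr0 mulr0 normr_le0 subr_eq0 => /eqP.
have oW : open W by exact: ball_open.
have oGW : open (G @` W).
  rewrite openE => _ [u1 Wu1 <-].
  have : nbhs u1 W by exact: open_nbhs_nbhs.
  move=> /nbhs_ballP[s /= s0 sW].
  pose B := closed_ball u1 (s / 2).
  have s20 : 0 < s / 2 by rewrite divr_gt0.
  have BW : B `<=` W.
    by apply: subset_trans sW; apply: closed_ball_subset => //; lra.
  (* For z this close to G u1, [Phi z] moves the centre u1 by at most s/4 and halves distances, so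
     it maps the closed ball of radius s/2 into itself; its fixed point is a preimage of z. The 1 in
     a + 1 guards against a = 0. *)
  have d0 : 0 < s / 4 / (a + 1) by rewrite !divr_gt0// ltr_wpDl.
  apply/nbhs_ballP; exists (s / 4 / (a + 1)) => //= z.
  rewrite -ball_normE /= => Gz.
  have BB : set_fun B B (Phi z).
    move=> u Bu; move: (Bu); rewrite /B closed_ballE// /closed_ball_ /= => us.
    have := Phi_lip z u u1 (BW _ Bu) (sW _ (ballxx _ s0)).
    have : `|Phi z u1 - u1| <= s / 4.
      rewrite /Phi addrAC subrr sub0r normrN (le_trans (Aa _))//.
      move: Gz; rewrite ltr_pdivlMr ?ltr_wpDl// mulrDr mulr1 mulrC => /ltW.
      by apply: le_trans; rewrite lerDl.
    have := ler_distD (Phi z u1) u1 (Phi z u).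
    rewrite (distrC u1 (Phi z u1)) (distrC (Phi z u1) (Phi z u)).
    by rewrite (distrC u u1); move: us; lra.
  pose P : {fun B >-> B} := HB.pack (Phi z) (isFun.Build _ _ B B (Phi z) BB).
  have cP : is_contraction P.
    exists (2^-1)%:nng; split=> [|[u u'] [/= Bu Bu']]; first by rewrite /=; lra.
    exact: (Phi_lip z u u' (BW _ Bu) (BW _ Bu')).
  have [||u Bu uE] := banach_fixed_point cP.
  - exact: closed_ball_closed.
  - by exists u1; exact: closed_ballxx.
  exists u; first exact: BW.
  move: uE; rewrite /P /= /Phi => /eqP; rewrite -subr_eq0 opprB subrKC.
  move=> /eqP /(canRL (mulmxK uA)); rewrite mul0mx => /eqP.
  by rewrite subr_eq0 => /eqP.
(* Chooses a preimage in [W]; [u0] is a default value outside the image. *)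
pose psi z := xget u0 [set u | W u /\ G u = z].
have psiP z : (G @` W) z -> W (psi z) /\ G (psi z) = z.
  move=> [u Wu <-].
  by apply: (@xgetPex _ u0 [set u' | W u' /\ G u' = G u]); exists u.
have psiK u : W u -> psi (G u) = u.
  move=> Wu; have [|Wp Gp] := psiP (G u); first by exists u.
  exact: G_inj.
have dpsi z : (G @` W) z ->
    is_diff z psi (mulmxr (invmx (jacobian G (psi z)))).
  move=> /[dup] GWz /psiP[Wu Gu]; set u := psi z in Wu Gu *.
  set D := invmx _; apply: near_diff; first exact: mulmxr_cont.
  move=> eps eps0.
  pose b : R := n%:R * `|D|.
  have b0 : 0 <= b by rewrite mulr_ge0.
  have Db (w : 'rV[R]_n) : `|w *m D| <= b * `|w|.
    by apply: mulmx_norm_le => // i j; exact: ler_mx_norm.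
  (* With error eps / c in the expansion of G, the error for psi is at most b (eps / c) 2 a |h| <=
     eps |h|. *)
  pose c := 2 * a * b + 1.
  have c0 : 0 < c by rewrite ltr_wpDl// !mulr_ge0.
  have e1 : 0 < eps / c by rewrite divr_gt0.
  have := diff_near (dG (rU _ Wu)) e1.
  move=> /nbhs_ballP[d /= d0 dB].
  have : nbhs z (G @` W) by exact: open_nbhs_nbhs.
  rewrite [nbhs z _](near_shift 0 z) subr0 => GW0.
  have a1 : 0 < 2 * a + 1 by lra.
  have : nbhs (0 : 'rV[R]_n) (ball (0 : 'rV[R]_n) (d / (2 * a + 1))).
    by apply: nbhsx_ballx; rewrite divr_gt0.
  move=> B0; near=> h.
  have GWh : (G @` W) (h + z) by near: h; exact: GW0.
  have [Wh Gh] := psiP _ GWh.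
  have hd : `|h| < d / (2 * a + 1).
    have : ball (0 : 'rV[R]_n) (d / (2 * a + 1)) h by near: h; exact: B0.
    by rewrite -ball_normE /= sub0r normrN.
  pose k := psi (h + z) - u.
  have kh : `|k| <= 2 * a * `|h|.
    by have := G_lip _ _ Wh Wu; rewrite Gh Gu addrK.
  have kd : `|k| < d.
    apply: le_lt_trans kh _; move: hd; rewrite ltr_pdivlMr//.
    by have := normr_ge0 h; set x := `|h|; lra.
  have : `|h - k *m jacobian G u| <= eps / c * `|k|.
    have := dB k; rewrite -ball_normE /= sub0r normrN => /(_ kd).
    by rewrite /k subrK Gh Gu addrK mul_rV_lin1.
  rewrite -/k /= => hk.
  have -> : k - h *m D = - ((h - k *m jacobian G u) *m D).
    by rewrite mulmxBl (mulmxK (Ju _ Wu)) opprB.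
  rewrite normrN; apply: le_trans (Db _) _.
  apply: (@le_trans _ _ (b * (eps / c * (2 * a * `|h|)))).
    exact: (ler_wpM2l b0 (le_trans hk (ler_wpM2l (ltW e1) kh))).
  rewrite (_ : b * _ = eps * `|h| * ((2 * a * b) / c)); last by ring.
  apply: ler_piMr; first by rewrite mulr_ge0 ?(ltW eps0).
  by rewrite (ler_pdivrMr _ _ c0) mul1r lerDl ler01.
exists W, psi; split; [split => //|split => //].
  exact: ballxx.
(* Bootstrap: the derivative of psi is the inverse Jacobian composed with psi, so it is C^k as soon
   as psi is. *)
elim=> [|k IH].
  by move=> z /dpsi[dz _]; exact: differentiable_continuous.
split=> [z /dpsi[]//|v].
have CJ : Ck k (G @` W) (fun z => v *m invmx (jacobian G (psi z))).
  apply: (Ck_mulmx oGW (Ck_cst _ _ _)); apply: (Ck_invmx oGW).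
    by move=> z /psiP[/Ju].
  apply: (Ck_comp oGW oW (f := jacobian G) _ _ IH); first by move=> z /psiP[].
  by apply: Ck_subset rU _; apply: Ck_jacobian.
apply: (Ck_eq oGW _ CJ) => z; rewrite inE => /dpsi[dz Dz].
by rewrite deriveE// Dz.
Unshelve. all: by end_near. Qed.

End LocalInverse.
End InverseFunction.

(** * Functions with a rotating gradient *)

Section RotatingGradient.
Context {R : realType}.

Lemma ball_is_derive_0_cst (g : R -> R) (x0 r : R) :
  (forall x, `|x - x0| < r -> is_derive x (1 : R) g 0) ->
  forall x, `|x - x0| < r -> g x = g x0.
Proof.
move=> dg x xr.
have xx (u v : R) : `|u - x0| < r -> `|v - x0| < r -> u < v -> g v = g u.
  move=> ur vr uv.
  have bd (t : R) : t \in `[u, v]%R -> `|t - x0| < r.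
    rewrite in_itv /= => /andP[ut tv]; move: ur vr; rewrite !ltr_norml.
    by move=> /andP[? ?] /andP[? ?]; apply/andP; split; lra.
  have gc : {within `[u, v], continuous g}.
    by apply: derivable_within_continuous => t /bd /dg[].
  have g0 (t : R) : t \in `]u, v[%R -> is_derive t (1 : R) g (cst 0 t).
    by move=> tuv; apply/dg/bd; exact: subset_itv_oo_cc tuv.
  have [c _] := MVT uv g0 gc.
  by rewrite mul0r => /eqP; rewrite subr_eq0 => /eqP.
have x0r : `|x0 - x0| < r by rewrite subrr normr0; exact: le_lt_trans xr.
by have [xx0|xx0|->//] := ltgtP x x0; [apply/esym|]; exact: xx.
Qed.

(** The product al(x) exp(- k (x - x0)) has zero derivative. *)
Lemma ball_exp_solution (al : R -> R) (k x0 r : R) :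
  (forall x, `|x - x0| < r -> is_derive x (1 : R) al (k * al x)) ->
  forall x, `|x - x0| < r -> al x = al x0 * expR (k * (x - x0)).
Proof.
move=> dal x xr.
have dg (t : R) : `|t - x0| < r ->
    is_derive t (1 : R) (fun t => al t * expR (- (k * (t - x0)))) 0.
  move=> /dal dalt; apply: is_derive_eq.
  by rewrite /GRing.scale /=; ring.
have := ball_is_derive_0_cst dg xr.
rewrite subrr mulr0 oppr0 expR0 mulr1 => <-.
by rewrite -mulrA -expRD addNr expR0 mulr1.
Qed.

(** Taking s at most pi / (2 |k|) keeps |k| s strictly between 0 and pi. This supplies arbitrarily
    small nontrivial rotations. *)
Lemma sin_neq0_near0 (k r : R) : k != 0 -> 0 < r ->
  exists s, [/\ 0 < s, s < r & sin (k * s) != 0].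
Proof.
move=> k0 r0; have pi0 : 0 < pi :> R by exact: pi_gt0.
have ak0 : 0 < `|k| by rewrite normr_gt0.
pose s := Num.min (r / 2) (pi / 2 / `|k|).
have s0 : 0 < s by rewrite lt_min !divr_gt0.
exists s; split=> //; first by rewrite gt_min; apply/orP; left; lra.
have : 0 < sin (`|k| * s).
  apply: sin_gt0_pi; rewrite mulr_gt0//= mulrC -ltr_pdivlMr// gt_min.
  by apply/orP; right; rewrite ltr_pM2r ?invr_gt0//; lra.
case: (ler0P k) => _; last by move/lt0r_neq0.
by rewrite mulNr sinN oppr_gt0 lt_neqAle => /andP[].
Qed.

(** Here (P, Q) is the gradient of f. Rotation along b expresses everything through the values on
    the line b = b0, and comparing two expressions for f_a shows that these values solve y' = k
    y. *)
Lemma rotating_gradient (k a0 b0 r : R) (f P Q : R -> R -> R) :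
  k != 0 -> 0 < r ->
  (forall a b, `|a - a0| < r -> `|b - b0| < r ->
    is_derive a (1 : R) (f^~ b) (P a b) /\ is_derive b (1 : R) (f a) (Q a b)) ->
  (forall a, `|a - a0| < r ->
    derivable (P^~ b0) a (1 : R) /\ derivable (Q^~ b0) a (1 : R)) ->
  (forall a b, `|a - a0| < r -> `|b - b0| < r ->
    P a b = cos (k * (b - b0)) * P a b0 + sin (k * (b - b0)) * Q a b0 /\
    Q a b = cos (k * (b - b0)) * Q a b0 - sin (k * (b - b0)) * P a b0) ->
  exists A B C : R, forall a b, `|a - a0| < r -> `|b - b0| < r ->
    [/\ f a b = C + expR (k * (a - a0)) *
          (cos (k * (b - b0)) * A + sin (k * (b - b0)) * B) / k,
        P a b = expR (k * (a - a0)) *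
          (cos (k * (b - b0)) * A + sin (k * (b - b0)) * B) &
        Q a b = expR (k * (a - a0)) *
          (cos (k * (b - b0)) * B - sin (k * (b - b0)) * A)].
Proof.
move=> k0 r0 df dPQ rot.
pose al a := P a b0; pose be a := Q a b0.
have b0r : `|b0 - b0| < r by rewrite subrr normr0.
have a0r : `|a0 - a0| < r by rewrite subrr normr0.
(* Integration of f_b = Q in b, the rotated formula for Q having an explicit primitive. *)
have fE a b : `|a - a0| < r -> `|b - b0| < r ->
    f a b = f a b0 +
      ((cos (k * (b - b0)) - 1) * al a + sin (k * (b - b0)) * be a) / k.
  move=> ar br.
  have dg (t : R) : `|t - b0| < r -> is_derive t (1 : R) (fun t => f a t -
      (cos (k * (t - b0)) * al a + sin (k * (t - b0)) * be a) * k^-1) 0.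
    move=> tr; have [_ dft] := df a t ar tr.
    apply: is_derive_eq; rewrite (rot a t ar tr).2 -/(al a) -/(be a).
    by rewrite /GRing.scale /=; field.
  have := ball_is_derive_0_cst dg br.
  rewrite subrr mulr0 cos0 sin0 => /eqP; rewrite subr_eq => /eqP ->.
  by field.
have [dal dbe] : (forall a, `|a - a0| < r -> is_derive a (1 : R) al (k * al a)) /\
    (forall a, `|a - a0| < r -> is_derive a (1 : R) be (k * be a)).
  suff dd a : `|a - a0| < r ->
      is_derive a (1 : R) al (k * al a) /\ is_derive a (1 : R) be (k * be a).
    by split=> a /dd[].
  move=> ar.
  have [/derivableP dala /derivableP dbea] := dPQ a ar.
  rewrite -/al -/be in dala dbea.
  move: ('D_1 al a) ('D_1 be a) dala dbea => al' be' dala dbea.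
  (* Compare the derivative in a of [fE] with the rotated value of P; the
     identity then holds for b0 + s and b0 - s, which separates its terms. *)
  have key b : `|b - b0| < r ->
      (1 - cos (k * (b - b0))) * (al a - al' / k) +
      sin (k * (b - b0)) * (be' / k - be a) = 0.
    move=> br.
    have [dfb _] := df a b ar br.
    have [df0 _] := df a b0 ar b0r.
    have : is_derive a (1 : R) (f^~ b) (al a +
        ((cos (k * (b - b0)) - 1) * al' + sin (k * (b - b0)) * be') / k).
      have dg : is_derive a (1 : R) (fun a => f a b0 +
        ((cos (k * (b - b0)) - 1) * al a + sin (k * (b - b0)) * be a) * k^-1) (al a +
        ((cos (k * (b - b0)) - 1) * al' + sin (k * (b - b0)) * be') / k).
        by apply: is_derive_eq; rewrite /GRing.scale /= /al; ring.
      apply: near_eq_is_derive dg.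
      have : \forall t \near a, `|t - a0| < r.
        have : open [set t : R | `|t - a0| < r].
          rewrite (_ : mkset _ = ball a0 r); first exact: ball_open.
          by apply/seteqP; split=> t; rewrite -ball_normE /= distrC.
        by move=> /near_in; apply.
      by apply: filterS => t tr; rewrite (fE t b tr br).
    move=> [_ D1]; case: dfb => _; rewrite D1 (rot a b ar br).1 -/(al a) -/(be a).
    move=> E; rewrite -(subrr
      (cos (k * (b - b0)) * al a + sin (k * (b - b0)) * be a)) -{1}E.
    by field.
  have [s [s0 sr sin0]] := sin_neq0_near0 k0 r0.
  have cos1 : 1 - cos (k * s) != 0.
    apply: contra sin0; rewrite subr_eq0 => /eqP c1.
    by rewrite -sqrf_eq0 sin2cos2 -c1 expr1n subrr.
  have K1 := key (b0 + s); have K2 := key (b0 - s).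
  rewrite addrAC subrr add0r (gtr0_norm s0) in K1.
  rewrite addrAC subrr add0r normrN (gtr0_norm s0) mulrN cosN sinN in K2.
  have {}K1 := K1 sr; have {}K2 := K2 sr.
  have E1 : sin (k * s) * (be' / k - be a) = 0 by move: K1 K2; lra.
  have E2 : (1 - cos (k * s)) * (al a - al' / k) = 0 by move: K1 K2; lra.
  move/eqP : E1; rewrite mulf_eq0 (negbTE sin0) /= subr_eq0 => /eqP E1.
  move/eqP : E2; rewrite mulf_eq0 (negbTE cos1) /= subr_eq0 => /eqP E2.
  by split; [rewrite E2|rewrite -E1]; rewrite mulrC divfK.
have alE := ball_exp_solution dal; have beE := ball_exp_solution dbe.
exists (al a0), (be a0), (f a0 b0 - al a0 / k) => a b ar br.
(* On b = b0 one has f_a = al = al' / k, so f - al / k is constant there. *)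
have f0E : f a b0 = f a0 b0 - al a0 / k + al a / k.
  have dg (t : R) : `|t - a0| < r ->
      is_derive t (1 : R) (fun t => f t b0 - al t * k^-1) 0.
    move=> tr; have [dft _] := df t b0 tr b0r; have dalt := dal t tr.
    by apply: is_derive_eq; rewrite /GRing.scale /= /al; field.
  have /eqP := ball_is_derive_0_cst dg ar.
  by rewrite subr_eq => /eqP.
have [PE QE] := rot a b ar br.
rewrite PE QE (fE a b ar br) f0E -/(al a) -/(be a) (alE a ar) (beE a ar).
by split; field.
Qed.

End RotatingGradient.

(** * Vectors of space *)

Lemma det_mx22 (R : comRingType) (A : 'M[R]_2) :
  \det A = A 0 0 * A 1 1 - A 0 1 * A 1 0.
Proof.
rewrite (expand_det_row _ 0) !big_ord_recl big_ord0 addr0.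
rewrite /cofactor !det_mx11 !mxE /= expr0 expr1 mul1r mulN1r mulrN.
by congr (_ * A _ _ - A _ _ * A _ _); exact: val_inj.
Qed.

Lemma det_mx33 (R : comRingType) (A : 'M[R]_3) :
  \det A = A 0 0 * (A 1 1 * A 2 2 - A 1 2 * A 2 1)
    - A 0 1 * (A 1 0 * A 2 2 - A 1 2 * A 2 0)
    + A 0 2 * (A 1 0 * A 2 1 - A 1 1 * A 2 0).
Proof.
have AE (i i' j j' : 'I_3) : val i = val i' -> val j = val j' -> A i j = A i' j'.
  by move=> /val_inj -> /val_inj ->.
rewrite (expand_det_row _ 0) !big_ord_recl big_ord0 addr0 addrA.
rewrite /cofactor !det_mx22 !mxE /= expr0 expr1 mul1r mulN1r mulrN sqrrN.
rewrite expr1n mul1r.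
by congr (_ + _ + _); [congr (_ * (_ * _ - _ * _))|
  congr (- (_ * (_ * _ - _ * _)))|congr (_ * (_ * _ - _ * _))]; apply: AE.
Qed.

Section Vectors.
Context {R : realType}.
Implicit Types (u v w e f : 'rV[R]_3).

Lemma dot3E u v : dot u v = u 0 0 * v 0 0 + u 0 1 * v 0 1 + u 0 2 * v 0 2.
Proof.
rewrite /dot !big_ord_recl big_ord0 addr0 addrA.
by congr (_ + _ + _); congr (u _ _ * v _ _); apply: val_inj.
Qed.

Lemma vec3E (a b c : R) :
  (vec3 a b c 0 0 = a) * (vec3 a b c 0 1 = b) * (vec3 a b c 0 2 = c).
Proof. by rewrite !mxE. Qed.

Lemma crossE u v : cross u v = vec3 (u 0 1 * v 0 2 - u 0 2 * v 0 1)
  (u 0 2 * v 0 0 - u 0 0 * v 0 2) (u 0 0 * v 0 1 - u 0 1 * v 0 0).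
Proof.
have i0 : inord 0 = 0 :> 'I_3 by apply: val_inj; rewrite /= inordK.
have i1 : inord 1 = 1 :> 'I_3 by apply: val_inj; rewrite /= inordK.
have i2 : inord 2 = 2 :> 'I_3 by apply: val_inj; rewrite /= inordK.
by rewrite /cross i0 i1 i2.
Qed.

Lemma row3P u v :
  [/\ u 0 0 = v 0 0, u 0 1 = v 0 1 & u 0 2 = v 0 2] -> u = v.
Proof.
move=> [h0 h1 h2]; apply/rowP => -[[|[|[|//]]] i].
- by rewrite (_ : Ordinal i = 0)//; exact: val_inj.
- by rewrite (_ : Ordinal i = 1)//; exact: val_inj.
- by rewrite (_ : Ordinal i = 2)//; exact: val_inj.
Qed.

Lemma vec3D (a b c a' b' c' : R) :
  vec3 a b c + vec3 a' b' c' = vec3 (a + a') (b + b') (c + c').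
Proof. by apply: row3P; rewrite !mxE. Qed.

Lemma vec3Z (t a b c : R) : t *: vec3 a b c = vec3 (t * a) (t * b) (t * c).
Proof. by apply: row3P; rewrite !mxE. Qed.

(* For orthonormal e and f the rows form a direct orthonormal basis. *)
Definition frame_mx e f : 'M[R]_3 :=
  \matrix_(i, j) [:: cross f e; f; e]`_i 0 j.

Lemma mul_frame_mx e f w : w *m (frame_mx e f)^T =
  vec3 (dot w (cross f e)) (dot w f) (dot w e).
Proof.
apply: row3P; rewrite !vec3E.
by split; rewrite mxE; apply: eq_bigr => j _; rewrite !mxE.
Qed.

Lemma dot_crossl u v : dot (cross u v) u = 0.
Proof. by rewrite crossE !dot3E !mxE /=; ring. Qed.

Lemma dot_crossr u v : dot (cross u v) v = 0.
Proof. by rewrite crossE !dot3E !mxE /=; ring. Qed.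

Lemma dotC u v : dot u v = dot v u.
Proof. by rewrite !dot3E; ring. Qed.

Section Frame.
Variables e f : 'rV[R]_3.
Hypotheses (e1 : dot e e = 1) (f1 : dot f f = 1) (fe : dot f e = 0).

(** Lagrange's identity for the squared length of a cross product. *)
Let fe1 : dot (cross f e) (cross f e) = 1.
Proof.
transitivity (dot f f * dot e e - dot f e ^+ 2); last first.
  by rewrite e1 f1 fe expr0n subr0 mulr1.
by rewrite crossE !dot3E !mxE /=; ring.
Qed.

Lemma frame_mx_orthogonal : frame_mx e f *m (frame_mx e f)^T = 1%:M.
Proof.
apply/row_matrixP => i; rewrite row_mul mul_frame_mx.
have -> : row i (frame_mx e f) = [:: cross f e; f; e]`_i.
  by apply/rowP => j; rewrite !mxE.
case: i => -[|[|[|//]]] i /=; rewrite ?fe1 ?dot_crossl ?dot_crossr ?e1 ?f1 ?fe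
  ?(dotC f (cross _ _)) ?(dotC e (cross _ _)) ?(dotC e f)
  ?dot_crossl ?dot_crossr ?fe;
by apply: row3P; rewrite !mxE.
Qed.

(** The determinant is the triple product of f x e, f and e, that is, the squared length of f x
    e. *)
Lemma det_frame_mx : \det (frame_mx e f) = 1.
Proof.
by rewrite -fe1 det_mx33 dot3E /frame_mx crossE !mxE /=; ring.
Qed.

(** In the frame, e x acts as the quarter turn (y0, y1) -> (- y1, y0) of the horizontal coordinates;
    this brings Rodrigues' formula to the usual rotation matrix. *)
Lemma frame_mx_cross w : cross e w *m (frame_mx e f)^T =
  vec3 (- dot w f) (dot w (cross f e)) 0.
Proof.
rewrite mul_frame_mx; congr vec3.
- transitivity (dot f e * dot w e - dot e e * dot w f).
    by rewrite !crossE !dot3E !mxE /=; ring.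
  by rewrite fe e1 mul0r mul1r sub0r.
- by rewrite !crossE !dot3E !mxE /=; ring.
- by rewrite !crossE !dot3E !mxE /=; ring.
Qed.

End Frame.

Lemma dot_orthogonal (Q : 'M[R]_3) u v : Q *m Q^T = 1%:M ->
  dot (u *m Q^T) (v *m Q^T) = dot u v.
Proof.
have dotE a b : dot a b = (a *m b^T) 0 0 :> R.
  by rewrite mxE; apply: eq_bigr => i _; rewrite mxE.
move=> /mulmx1C QQ; rewrite !dotE trmx_mul trmxK -mulmxA (mulmxA _ Q) QQ mul1mx.
by [].
Qed.

Lemma dotZl (a : R) u v : dot (a *: u) v = a * dot u v.
Proof. by rewrite !dot3E !mxE; ring. Qed.

Lemma dotDl u v w : dot (u + v) w = dot u w + dot v w.
Proof. by rewrite !dot3E !mxE; ring. Qed.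

Lemma dot_eq0 u : dot u u = 0 -> u = 0.
Proof.
rewrite dot3E => u0; apply: row3P; rewrite !mxE.
have [[a0 b0] c0] := (sqr_ge0 (u 0 0), sqr_ge0 (u 0 1), sqr_ge0 (u 0 2)).
by split; apply/eqP; rewrite -sqrf_eq0; apply/eqP; move: u0 a0 b0 c0; lra.
Qed.

(** For v <> 0 take f = - v/|v| and m = |v|. For v = 0 any unit vector orthogonal to e serves, with
    m = 0; this case is excluded only later. *)
Lemma unit_normal_direction e v : dot e e = 1 -> dot v e = 0 ->
  exists f (m : R), [/\ dot f f = 1, dot f e = 0, 0 <= m & v = - m *: f].
Proof.
move=> e1 ve.
have unit w : dot w w != 0 -> 0 < Num.sqrt (dot w w) /\
    dot ((- (Num.sqrt (dot w w))^-1) *: w) ((- (Num.sqrt (dot w w))^-1) *: w) = 1.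
  move=> w0; have w1 : 0 < dot w w.
    by rewrite lt_def w0 dot3E !addr_ge0// -expr2 sqr_ge0.
  have s0 : 0 < Num.sqrt (dot w w) by rewrite sqrtr_gt0.
  split=> //; rewrite dotZl dotC dotZl -{3}(sqr_sqrtr (ltW w1)).
  by field; rewrite gt_eqF.
have [vv|/unit[s0 vv]] := eqVneq (dot v v) 0; last first.
  exists (- (Num.sqrt (dot v v))^-1 *: v), (Num.sqrt (dot v v)); split => //.
  - by rewrite dotZl ve mulr0.
  - by rewrite scalerA mulrNN mulfV ?scale1r// gt_eqF.
(* The horizontal part of e turned by a right angle, or the first basis vector when that part is
   zero. *)
have [w we w0] : exists2 w, dot w e = 0 & dot w w != 0.
  have [e01|e01] := eqVneq (e 0 0 ^+ 2 + e 0 1 ^+ 2) 0; last first.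
    exists (vec3 (- e 0 1) (e 0 0) 0); rewrite dot3E !mxE /=; first by ring.
    by apply: contra e01 => /eqP <-; apply/eqP; ring.
  exists (vec3 1 0 0); rewrite dot3E !mxE /=; last first.
    by rewrite !mulr0 !addr0 mulr1 oner_neq0.
  rewrite !mul0r !addr0 mul1r; apply/eqP; rewrite -sqrf_eq0; apply/eqP.
  by move: e01; have := sqr_ge0 (e 0 0); have := sqr_ge0 (e 0 1); lra.
have [_ ww] := unit w w0.
exists (- (Num.sqrt (dot w w))^-1 *: w), 0; split => //.
- by rewrite dotZl we mulr0.
- by rewrite (dot_eq0 vv) oppr0 scale0r.
Qed.

(** With e the direction of l and p the normal of P, testing orthogonality on e - (e.p) p gives
    (e.p)^2 = 1, whence p - (e.p) e has length 0. *)
Lemma orthogonal_line_planeP (l : oriented_line R) (P : oriented_plane R) :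
  orthogonal_line_plane l P -> exists c : R, plane_normal P = c *: line_dir l.
Proof.
case: l => q e e1; case: P => q' p p1; rewrite /orthogonal_line_plane /=.
rewrite /parallel_to_plane /= => lP.
have := lP (e + (- dot e p) *: p).
rewrite dotDl dotZl p1 mulr1 subrr => /(_ erefl).
rewrite dotC dotDl dotZl e1 (dotC p e) mulNr => ep.
exists (dot e p); apply/eqP; rewrite -subr_eq0; apply/eqP/dot_eq0.
set c := dot e p in ep *.
have -> : dot (p - c *: e) (p - c *: e) =
    dot p p - 2 * c * dot e p + c ^+ 2 * dot e e.
  by rewrite !dot3E !mxE; ring.
by rewrite p1 e1 -/c; move: ep; lra.
Qed.

End Vectors.

(** * Charts and degenerate Gauss maps *)

Lemma open_setI_preimage (T T' : topologicalType) (f : T -> T') (D : set T)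
    (O : set T') : open D -> (forall p, D p -> {for p, continuous f}) ->
  open O -> open (D `&` f @^-1` O).
Proof.
move=> oD cf oO; rewrite openE => p [Dp Op]; apply: filterI.
  exact: open_nbhs_nbhs.
by apply: (cf p Dp); exact: open_nbhs_nbhs.
Qed.

Section Charts.
Context {R : realType} {M : topologicalType} (A : set (chart R M)).
Hypothesis chartA : forall c, A c -> smooth_chart A c.

Lemma chart_near (c : chart R M) (O : set M) u : is_chart c -> open O ->
  cimg c u -> O (cinv c u) -> \forall t \near u, cimg c t /\ O (cinv c t).
Proof.
move=> [_ oc _ _ _ _ _ cic] oO cu Ou.
have := open_setI_preimage oc cic oO.
rewrite openE => /(_ u); apply; split => //.
Qed.

Section Reparametrization.
Variables (c : chart R M) (W V : set 'rV[R]_2) (G psi : 'rV[R]_2 -> 'rV[R]_2).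
Hypotheses (sc : smooth_chart A c) (oW : open W) (oV : open V)
  (Wc : W `<=` cimg c) (GV : forall u, W u -> V (G u))
  (psiW : forall z, V z -> W (psi z)) (GK : forall u, W u -> psi (G u) = u)
  (psiK : forall z, V z -> G (psi z) = z)
  (sG : smooth_on W G) (spsi : smooth_on V psi).

Definition reparam_chart : chart R M :=
  Chart (cdom c `&` cfun c @^-1` W) V (G \o cfun c) (cinv c \o psi).

(** The transitions with an atlas chart are those of [c] composed with [psi] on one side or [G] on
    the other. *)
Lemma smooth_reparam_chart : smooth_chart A reparam_chart.
Proof.
have [[od oi fi di fK iK cf ci] tr] := sc.
have odW : open (cdom c `&` cfun c @^-1` W) by exact: open_setI_preimage.
split.
  apply: IsChart => /=.
  - exact: odW.
  - exact: oV.
  - by move=> p [dp Wp]; exact: GV.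
  - move=> z Vz; have Wz := psiW Vz; split; first exact/di/Wc.
    by rewrite /= iK//; exact: Wc.
  - by move=> p [dp Wp]; rewrite GK// fK.
  - by move=> z Vz; rewrite iK ?psiK//; apply/Wc/psiW.
  - move=> p [dp Wp]; apply: continuous_comp; first exact: cf.
    exact: (sG 0).
  - move=> z Vz; apply: continuous_comp; first exact: (spsi 0).
    by apply: ci; exact/Wc/psiW.
move=> c' Ac'; have [tcc' tc'c] := tr c' Ac'.
have [[od' oi' fi' di' fK' iK' cf' ci'] _] := chartA Ac'.
split=> k.
- have oU : open (cimg c `&` cinv c @^-1` cdom c') by exact: open_setI_preimage.
  have oUV : open (V `&` (cinv c \o psi) @^-1` cdom c').
    apply: open_setI_preimage => // z Vz; apply: continuous_comp.
      exact: (spsi 0).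
    by apply: ci; exact/Wc/psiW.
  apply: (Ck_comp oUV oU _ (tcc' k)) => [z [Vz z']|].
    by split=> //; exact/Wc/psiW.
  by apply: Ck_subset (spsi k) => z [].
- have oU : open (cimg c' `&` cinv c' @^-1` (cdom c `&` cfun c @^-1` W)).
    exact: open_setI_preimage.
  apply: (Ck_comp (g := cfun c \o cinv c') oU oW _ (sG k)) => [z [_ []//]|].
  by apply: Ck_subset (tc'c k) => z [? []].
Qed.

End Reparametrization.
End Charts.

Lemma derive_dot (R : realType) (V : normedModType R) n (F H : V -> 'rV[R]_n) u w :
  differentiable F u -> differentiable H u ->
  'D_w (fun t => dot (F t) (H t)) u = dot ('D_w F u) (H u) + dot (F u) ('D_w H u).
Proof.
move=> dF0 dH0.
have dF : derivable F u w by exact: diff_derivable.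
have dH : derivable H u w by exact: diff_derivable.
have cF i : derivable (fun t => F t 0 i) u w by move/derivable_mxP : dF; apply.
have cH i : derivable (fun t => H t 0 i) u w by move/derivable_mxP : dH; apply.
rewrite (_ : (fun t => dot _ _) =
    \sum_(i < n) ((fun t => F t 0 i) * (fun t => H t 0 i))); last first.
  by apply/funext => t; rewrite fct_sumE.
rewrite derive_sum => [|i]; last exact: derivableM.
rewrite /dot -big_split; apply: eq_bigr => i _ /=.
rewrite deriveM// (derive_mx dF) (derive_mx dH) !mxE addrC /GRing.scale /=.
by congr (_ + _); exact: mulrC.
Qed.

(** * Degenerate Gauss maps and vanishing curvature gradient *)

Section Flat.
Context {R : realType} {M : topologicalType} (A : set (chart R M)).
Variables (x n : M -> 'rV[R]_3) (K : M -> R).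
Hypotheses (hM : smooth_surface A) (hx : immersion A x) (hn : gauss_map A x n)
  (hK : gaussian_curvature A x n K).

(** Differentiating dot (D_j x) n = 0 gives II_ij = - dot (D_j x) (D_i n). If all D_i n are
    multiples of one vector, this matrix is a product of a column and a row. *)
Lemma degenerate_second_form c u (m : 'rV[R]_3) (la : 'I_2 -> R) :
  A c -> cimg c u ->
  (forall i, partial i (n \o cinv c) u = la i *: m) ->
  \det (second_form (x \o cinv c) (n (cinv c u)) u) = 0.
Proof.
move=> Ac cu nm.
have [_ _ _ chartA] := hM; have [[_ oc _ _ _ _ _ _] _] := chartA c Ac.
have [sx _] := hx; have [sn _ nx] := hn.
have [b IIE] : exists b : 'I_2 -> R, forall i j,
    second_form (x \o cinv c) (n (cinv c u)) u i j = - la i * b j.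
  exists (fun j => dot (partial j (x \o cinv c) u) m) => i j; rewrite mxE.
  have [dX DX] := sx c Ac 2; have [dN _] := sn c Ac 1.
  have [dDX _] := DX (delta_mx 0 j).
  have /eqP : 'D_(delta_mx 0 i)
      (fun t => dot (partial j (x \o cinv c) t) ((n \o cinv c) t)) u = 0.
    rewrite (near_eq_derive (g := cst 0)) ?derive_cst//.
    have := near_in oc cu; apply: filterS => t ct.
    exact: nx.
  rewrite derive_dot; [|exact: dDX|exact: dN].
  rewrite addr_eq0 => /eqP ->.
  have := nm i; rewrite /partial => ->.
  by rewrite mulNr dotC dotZl dotC.
by rewrite det_mx22 !IIE; ring.
Qed.

Lemma flat_gradient_vanishes (O : set M) : open O ->
  (forall c u, A c -> cimg c u -> O (cinv c u) ->
    exists m (la : 'I_2 -> R), forall i, partial i (n \o cinv c) u = la i *: m) ->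
  forall p, O p -> gradient_vanishes A x K p.
Proof.
move=> oO nm p Op c Ac dp.
have [_ _ _ chartA] := hM; have ic := (chartA c Ac).1.
have [od oi fi di fK iK cf ci] := ic.
have Ou : O (cinv c (cfun c p)) by rewrite fK.
have K0 : \forall t \near cfun c p, (K \o cinv c) t = cst (0 : R^o) t.
  apply: filterS (chart_near ic oO (fi _ dp) Ou) => t [ct Ot].
  rewrite /= (hK Ac ct); have [m [la nmt]] := nm _ _ Ac ct Ot.
  by rewrite (degenerate_second_form Ac ct nmt) mul0r.
rewrite /gradient (_ : \row_i _ = 0) ?mul0mx//.
apply/rowP => i; rewrite !mxE /partial (near_eq_derive _ K0).
exact: derive_cst.
Qed.

(** On a great circle the derivatives of n are orthogonal to both n and e, hence multiples of n x
    e. *)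
Lemma equatorial_gradient_vanishes (O : set M) (e : 'rV[R]_3) : open O ->
  dot e e = 1 -> (forall p, O p -> dot (n p) e = 0) ->
  forall p, O p -> gradient_vanishes A x K p.
Proof.
move=> oO e1 ne; apply: flat_gradient_vanishes => // c u Ac cu Ou.
have [_ _ _ chartA] := hM; have ic := (chartA c Ac).1.
have [sn n1 _] := hn; have [dN _] := sn c Ac 1.
set f := n (cinv c u).
have f1 : dot f f = 1 by exact: n1.
have fe : dot f e = 0 by exact: ne.
exists (cross f e), (fun i => dot (partial i (n \o cinv c) u) (cross f e)) => i.
set w := partial i _ u.
have we : dot w e = 0.
  have : 'D_(delta_mx 0 i) (fun t => dot ((n \o cinv c) t) e) u = 0.
    rewrite (near_eq_derive (g := cst 0)) ?derive_cst//.
    by apply: filterS (chart_near ic oO cu Ou) => t [_]; exact: ne.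
  rewrite (derive_dot (H := cst e)); [|exact: dN|exact: differentiable_cst].
  rewrite derive_cst (_ : dot _ 0 = 0) ?addr0//.
  by rewrite /dot big1// => k _; rewrite mxE mulr0.
have wf : dot w f = 0.
  have : 'D_(delta_mx 0 i)
      (fun t => dot ((n \o cinv c) t) ((n \o cinv c) t)) u = 0.
    rewrite (_ : (fun t => _) = cst 1) ?derive_cst//.
    by apply/funext => t; exact: n1.
  rewrite derive_dot; [|exact: dN|exact: dN].
  rewrite [dot (_ u) _]dotC -mulr2n => /eqP; rewrite mulrn_eq0 /= => /eqP.
  exact.
(* Both sides are compared in the orthonormal frame f x e, f, e, where only the first coordinate of
   [w] survives. *)
have QQ := mulmx1C (frame_mx_orthogonal e1 f1 fe).
rewrite -[LHS]mulmx1 -QQ mulmxA mul_frame_mx we wf.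
rewrite -[RHS]mulmx1 -QQ mulmxA; congr (_ *m _).
rewrite mul_frame_mx !dotZl.
have := frame_mx_orthogonal e1 f1 fe.
move/(congr1 (row 0)); rewrite row_mul mul_frame_mx.
have -> : row 0 (frame_mx e f) = cross f e.
  by apply/rowP => j; rewrite !mxE.
move/rowP => E; have := E 0; have := E 1; have := E 2; rewrite !mxE /=.
by move=> -> -> ->; rewrite !mulr0 mulr1.
Qed.

(** The relation n = (n.e) e is linear, so it passes to the derivatives of n, which are all
    multiples of e. *)
Lemma polar_gradient_vanishes (O : set M) (e : 'rV[R]_3) : open O ->
  (forall p, O p -> n p = dot (n p) e *: e) ->
  forall p, O p -> gradient_vanishes A x K p.
Proof.
move=> oO ne; apply: flat_gradient_vanishes => // c u Ac cu Ou.
have [_ _ _ chartA] := hM; have ic := (chartA c Ac).1.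
have [sn n1 _] := hn; have [dN _] := sn c Ac 1.
exists e, (fun i => dot (partial i (n \o cinv c) u) e) => i.
pose L : {linear 'rV[R]_3 -> 'rV[R]_3} := mulmxr (e^T *m e).
have LE w : L w = dot w e *: e.
  rewrite /L /= mulmxA.
  have -> : w *m e^T = (dot w e)%:M.
    rewrite [LHS]mx11_scalar mxE; congr (_%:M).
    by apply: eq_bigr => k _; rewrite mxE.
  by rewrite mul_scalar_mx.
have cL : continuous L by exact: mulmxr_cont.
rewrite /partial [LHS](near_eq_derive (g := L \o (n \o cinv c))); last first.
  apply: filterS (chart_near ic oO cu Ou) => t [_ Ot].
  by rewrite /= -[RHS]/(L _) LE -ne.
have dNu := dN u cu.
rewrite deriveE; last first.
  by apply: differentiable_comp => //; exact: linear_differentiable.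
rewrite diff_comp//; last exact: linear_differentiable.
by rewrite diff_lin//= -[LHS]/(L _) LE -deriveE.
Qed.

End Flat.

(** * Graphs over the plane orthogonal to the axis *)

Lemma row2P (F : fieldType) (u v : 'rV[F]_2) :
  u 0 0 = v 0 0 -> u 0 1 = v 0 1 -> u = v.
Proof.
move=> h0 h1; apply/rowP => -[[|[|//]] i].
- by rewrite (_ : Ordinal i = 0)//; exact: val_inj.
- by rewrite (_ : Ordinal i = 1)//; exact: val_inj.
Qed.

Lemma restrict_chart (R : realType) (M : topologicalType) (A : set (chart R M))
    (c : chart R M) (V : set 'rV[R]_2) :
  (forall c, A c -> smooth_chart A c) -> smooth_chart A c ->
  open V -> V `<=` cimg c -> smooth_chart A (reparam_chart c V V id id).
Proof.
move=> hA sc oV Vc.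
by apply: smooth_reparam_chart => //; move=> k; exact: Ck_id.
Qed.

Lemma derive_mulmxr (R : realType) (V : normedModType R) n p (F : V -> 'rV[R]_n)
    (B : 'M[R]_(n, p)) u w : differentiable F u ->
  'D_w (fun t => F t *m B) u = 'D_w F u *m B.
Proof.
move=> dF.
have dL x : is_diff x (mulmxr B : 'rV[R]_n -> 'rV[R]_p) (mulmxr B).
  by split; [exact/linear_differentiable/mulmxr_cont|
             rewrite diff_lin//; exact: mulmxr_cont].
have [dC DC] := is_diff_comp (differentiableP dF) (dL (F u)).
by rewrite (deriveE _ dC) DC /= -deriveE.
Qed.

Section Graph.
Context {R : realType} {M : topologicalType} (A : set (chart R M)).
Variables (x n : M -> 'rV[R]_3).
Hypotheses (hM : smooth_surface A) (hx : immersion A x) (hn : gauss_map A x n).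
Variable Q : 'M[R]_3.
Hypothesis QQ : Q *m Q^T = 1%:M.

Definition in_frame (y : M -> 'rV[R]_3) (p : M) : 'rV[R]_3 := y p *m Q^T.

Let X := in_frame x.
Let N := in_frame n.

Let chartA c : A c -> smooth_chart A c. Proof. by case: hM => _ _ _; apply. Qed.

Lemma smooth_in_frame y c : A c -> smooth_map A y ->
  smooth_on (cimg c) (in_frame y \o cinv c).
Proof.
move=> Ac sy k; have [[_ oc _ _ _ _ _ _] _] := chartA Ac.
exact: (Ck_mulmx oc (sy c Ac k) (Ck_cst k _ Q^T)).
Qed.

Lemma tangent_in_frame c u w : A c -> cimg c u ->
  'D_w (X \o cinv c) u = 'D_w (x \o cinv c) u *m Q^T /\
  dot ('D_w (X \o cinv c) u) (N (cinv c u)) = 0.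
Proof.
move=> Ac cu; have [sx _] := hx; have [_ _ nx] := hn.
have [dx _] := sx c Ac 1.
have DX : 'D_w (X \o cinv c) u = 'D_w (x \o cinv c) u *m Q^T.
  exact: derive_mulmxr (dx u cu).
by split=> //; rewrite DX dot_orthogonal//; exact: nx.
Qed.

Definition graph_map (c : chart R M) (u : 'rV[R]_2) : 'rV[R]_2 :=
  \row_(i < 2) X (cinv c u) 0 (widen_ord (isT : (2 <= 3)%N) i).

Lemma graph_mapE c u : graph_map c u 0 0 = X (cinv c u) 0 0 /\
  graph_map c u 0 1 = X (cinv c u) 0 1.
Proof. by split; rewrite [LHS]mxE; congr (X _ _ _); exact: val_inj. Qed.

Lemma smooth_graph_map c : A c -> smooth_on (cimg c) (graph_map c).
Proof.
move=> Ac k; have [[_ oc _ _ _ _ _ _] _] := chartA Ac.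
apply: Ck_mx => // i j.
have := Ck_coord 0 (widen_ord (isT : (2 <= 3)%N) j) oc (smooth_in_frame Ac hx.1 k).
by apply: Ck_eq => // u _; rewrite [RHS]mxE.
Qed.

(** A tangent vector with zero horizontal part is orthogonal to N, whose third coordinate is
    nonzero, so it vanishes; the immersion property then kills its preimage w. *)
Lemma jacobian_graph_map c u : A c -> cimg c u -> N (cinv c u) 0 2 != 0 ->
  jacobian (graph_map c) u \in unitmx.
Proof.
move=> Ac cu N2; have [dG _] := smooth_graph_map Ac 1.
have [dX _] := smooth_in_frame Ac hx.1 1.
have [dx _] := hx.1 c Ac 1.
apply: unitmx_inj => w; rewrite -deriveEjacobian; last exact: dG.
have [DX XN] := tangent_in_frame w Ac cu.
set Y := 'D_w (X \o cinv c) u in DX XN.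
have dGw : derivable (graph_map c) u w by apply: diff_derivable; exact: dG.
have dXw : derivable (X \o cinv c) u w by apply: diff_derivable; exact: dX.
have GE i : 'D_w (graph_map c) u 0 i = Y 0 (widen_ord (isT : (2 <= 3)%N) i).
  rewrite /Y (derive_mx dGw) (derive_mx dXw) !mxE; congr ('D_w _ u).
  by apply/funext => t; rewrite [LHS]mxE.
move=> G0.
have Y0 : Y 0 0 = 0.
  rewrite -[LHS](_ : Y 0 (widen_ord (isT : (2 <= 3)%N) 0) = _).
    by rewrite -GE G0 mxE.
  by congr (Y _ _); exact: val_inj.
have Y1 : Y 0 1 = 0.
  rewrite -[LHS](_ : Y 0 (widen_ord (isT : (2 <= 3)%N) 1) = _).
    by rewrite -GE G0 mxE.
  by congr (Y _ _); exact: val_inj.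
have Y2 : Y 0 2 = 0.
  move: XN; rewrite dot3E Y0 Y1 !mul0r !add0r => /eqP.
  by rewrite mulf_eq0 (negbTE N2) orbF => /eqP.
have Yz : Y = 0 by apply: row3P; rewrite !mxE.
have xz : 'D_w (x \o cinv c) u = 0.
  by rewrite -[LHS]mulmx1 -(mulmx1C QQ) mulmxA -DX Yz mul0mx.
apply: (hx.2 c u Ac cu); rewrite -deriveE ?xz; last exact: dx.
by rewrite linear0.
Qed.

(** The chart coordinates are the first two frame coordinates: the surface appears as the graph of
    the third one. *)
Definition graph_chart_spec (c : chart R M) : Prop :=
  [/\ smooth_on (cimg c) (X \o cinv c), smooth_on (cimg c) (N \o cinv c),
      (forall u, cimg c u -> X (cinv c u) 0 0 = u 0 0 /\ X (cinv c u) 0 1 = u 0 1),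
      (forall u, cimg c u -> N (cinv c u) 0 2 != 0) &
      (forall u w, cimg c u -> dot ('D_w (X \o cinv c) u) (N (cinv c u)) = 0)].

(** The inverse function theorem turns the horizontal projection of an atlas chart into new
    coordinates near [p0]. *)
Lemma graph_chart p0 : N p0 0 2 != 0 -> exists c : chart R M,
  [/\ smooth_chart A c, cdom c p0 & graph_chart_spec c].
Proof.
move=> N2; have [_ _ cov _] := hM; have [c Ac cp0] := cov p0.
have [sn _ _] := hn.
have sc := chartA Ac; have [ic _] := sc.
have [od oc fi di fK iK cf ci] := ic.
pose u0 := cfun c p0; have cu0 : cimg c u0 by exact: fi.
pose U := cimg c `&` (fun u => N (cinv c u) 0 2) @^-1` [set y : R | y != 0].
have oU : open U.
  have CN : Ck 0 (cimg c) (fun u => N (cinv c u) 0 2).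
    exact: (Ck_coord 0 2 oc (smooth_in_frame Ac sn 0)).
  by apply: open_setI_preimage.
have Uc : U `<=` cimg c by move=> u [].
have Uu0 : U u0 by split=> //=; rewrite fK.
have sG : smooth_on U (graph_map c).
  by move=> k; apply: Ck_subset Uc _; exact: smooth_graph_map.
have uJ : jacobian (graph_map c) u0 \in unitmx.
  by apply: jacobian_graph_map => //; exact: Uu0.2.
have [W [psi [[oW Wu0 WU oGW] [GK spsi]]]] := inverse_function oU Uu0 sG uJ.
have Wc : W `<=` cimg c by exact: subset_trans Uc.
pose V := graph_map c @` W.
have GV u : W u -> V (graph_map c u) by exists u.
have psiW z : V z -> W (psi z) by move=> [u Wu <-]; rewrite GK.
have psiK z : V z -> graph_map c (psi z) = z by move=> [u Wu <-]; rewrite GK.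
have sGW : smooth_on W (graph_map c) by move=> k; exact: Ck_subset (sG k).
have sY y : smooth_map A y -> smooth_on V (in_frame y \o (cinv c \o psi)).
  move=> sy k; rewrite compA.
  by apply: (Ck_comp oGW oc _ (smooth_in_frame Ac sy k) (spsi k)) => z /psiW /Wc.
exists (reparam_chart c W V (graph_map c) psi); split.
- exact: smooth_reparam_chart.
- by split.
split.
- exact: sY hx.1.
- exact: sY sn.
- move=> z Vz; have [E0 E1] := graph_mapE c (psi z).
  by rewrite (psiK z Vz) in E0 E1; rewrite E0 E1.
- by move=> z /psiW /WU [].
- move=> z w Vz; have cz := Wc _ (psiW z Vz).
  have [dX _] := smooth_in_frame Ac hx.1 1.
  have [dpsi _] := spsi 1.
  rewrite /= compA deriveE; last first.
    by apply: differentiable_comp; [exact: dpsi|exact: dX].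
  rewrite diff_comp; [|exact: dpsi|exact: dX].
  rewrite /= -deriveE; last exact: dX.
  exact: (tangent_in_frame _ Ac cz).2.
Qed.

(** By continuity the flow keeps a small ball inside a larger graph chart for |t| < eps. There a
    point is determined by its horizontal coordinates, so the flow is a translation of the chart. *)
Lemma box_chart (phi : R -> M -> M) (m : R) p0 :
  continuous (fun q : R^o * M => phi q.1 q.2) -> (forall p, phi 0 p = p) ->
  (forall t p, X (phi t p) 0 0 = X p 0 0 /\ X (phi t p) 0 1 = X p 0 1 - t * m) ->
  N p0 0 2 != 0 ->
  exists (c : chart R M) (r eps : R),
  [/\ smooth_chart A c, cdom c p0, graph_chart_spec c &
  [/\ 0 < r, 0 < eps, 0 < m -> 2 * r <= eps * m, cimg c = ball (cfun c p0) r &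
   forall t z, `|t| < eps -> cimg c z -> cimg c (z - (t * m) *: delta_mx 0 1) ->
     phi t (cinv c z) = cinv c (z - (t * m) *: delta_mx 0 1)]].
Proof.
move=> phic phi0 phiX N2; have [c [sc cp0 [sX sN cX cN tX]]] := graph_chart N2.
have [ic _] := sc; have [od oc fi di fK iK cf ci] := ic.
pose z0 := cfun c p0; have cz0 : cimg c z0 by exact: fi.
have : nbhs ((0, p0) : R^o * M) ((fun q : R^o * M => phi q.1 q.2) @^-1` cdom c).
  apply: phic; rewrite /= phi0; exact: open_nbhs_nbhs.
move=> [[T O] /= [/nbhs_ballP[eps /= eps0 epsT] nO] TO].
have : nbhs z0 (cimg c `&` cinv c @^-1` O).
  apply: filterI; first exact: open_nbhs_nbhs.
  by apply: ci => //; rewrite /z0 fK.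
move=> /nbhs_ballP[r1 /= r10 r1O].
(* For m > 0 this radius lets the flow cross the ball from its centre in time less than eps. *)
pose r := if 0 < m then Num.min r1 (eps * m / 2) else r1.
have r0 : 0 < r.
  by rewrite /r; case: ifP => // m0; rewrite lt_min r10 divr_gt0// mulr_gt0.
have rr1 : r <= r1 by rewrite /r; case: ifP => // m0; rewrite ge_min lexx.
pose V := ball z0 r.
have Vr : V `<=` ball z0 r1 by exact: le_ball.
have Vc : V `<=` cimg c by move=> z /Vr /r1O [].
exists (reparam_chart c V V id id), r, eps; split.
- by apply: restrict_chart => //; exact: ball_open.
- by split=> //; exact: ballxx.
- split=> //=.
  + by move=> k; exact: Ck_subset (sX k).
  + by move=> k; exact: Ck_subset (sN k).
  + by move=> u /Vc; exact: cX.
  + by move=> u /Vc; exact: cN.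
  + by move=> u w /Vc; exact: tX.
split=> //=.
  move=> m0; rewrite /r m0; have : Num.min r1 (eps * m / 2) <= eps * m / 2.
    by rewrite ge_min lexx orbT.
  lra.
move=> t z teps Vz Vz'; have [cz Oz] := r1O _ (Vr _ Vz).
(* The moved point lies in the domain of the larger chart, where equality of coordinates gives
   equality of points. *)
have cp : cdom c (phi t (cinv c z)).
  apply: (TO (t, cinv c z)); split=> //=; apply: epsT.
  by rewrite -ball_normE /= sub0r normrN.
rewrite -[LHS]fK//; congr (cinv c _).
have [E0 E1] := cX _ (fi _ cp); have [F0 F1] := cX _ cz.
have [H0 H1] := phiX t (cinv c z).
rewrite fK// in E0 E1.
apply: row2P; rewrite !mxE /=.
- by rewrite -E0 H0 F0 mulr0 subr0.
- by rewrite -E1 H1 F1 mulr1.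
Qed.

End Graph.

Lemma derive_coord (R : realType) (V : normedModType R) m n (F : V -> 'M[R]_(m, n))
    u w i j : derivable F u w -> 'D_w F u i j = 'D_w (fun t => F t i j) u.
Proof. by move=> dF; rewrite derive_mx// mxE. Qed.

(** * The height function of a graph whose normal rotates *)

Section RotatingGraph.
Context {R : realType} {M : topologicalType}.
Variables (x n : M -> 'rV[R]_3) (Q : 'M[R]_3) (c : chart R M).
Variables (z0 : 'rV[R]_2) (r : R).
Hypotheses (r0 : 0 < r) (spec : graph_chart_spec x n Q c)
  (cball : cimg c = ball z0 r).

Let X := in_frame Q x.
Let N := in_frame Q n.
Let vec2 (a b : R) : 'rV[R]_2 := \row_(i < 2) [:: a; b]`_i.
Let a0 := z0 0 0.
Let b0 := z0 0 1.
Let e (i : 'I_2) : 'rV[R]_2 := delta_mx 0 i.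

Lemma ball_vec2 a b : `|a - a0| < r -> `|b - b0| < r -> cimg c (vec2 a b).
Proof.
move=> ar br; rewrite cball; split=> // i j; rewrite ord1.
case: j => -[|[|//]] j; rewrite /ball /= mxE /= distrC.
- by rewrite (_ : Ordinal j = 0)//; exact: val_inj.
- by rewrite (_ : Ordinal j = 1)//; exact: val_inj.
Qed.

Lemma vec2_ball u : cimg c u ->
  [/\ `|u 0 0 - a0| < r, `|u 0 1 - b0| < r & vec2 (u 0 0) (u 0 1) = u].
Proof.
rewrite cball => -[_ Bu]; have := Bu 0 0; have := Bu 0 1.
rewrite /ball /= ![`|z0 _ _ - _|]distrC => u1 u0; split => //.
by apply: row2P; rewrite !mxE.
Qed.

(** Coordinate lines in the affine form used by [is_derive_line]. *)
Let line0 a b : vec2 a b = vec2 0 b + a *: e 0.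
Proof. by apply: row2P; rewrite !mxE /=; ring. Qed.

Let line1 a b : vec2 a b = vec2 a 0 + b *: e 1.
Proof. by apply: row2P; rewrite !mxE /=; ring. Qed.

Let oc : open (cimg c). Proof. by rewrite cball; exact: ball_open. Qed.

(** By [height_derivative], [P] and [S] are the partial derivatives of the height [f]. *)
Let P a b := - N (cinv c (vec2 a b)) 0 0 / N (cinv c (vec2 a b)) 0 2.
Let S a b := - N (cinv c (vec2 a b)) 0 1 / N (cinv c (vec2 a b)) 0 2.
Let f a b := X (cinv c (vec2 a b)) 0 2.

(** The tangent vector along the i-th coordinate has horizontal part [e i]; its orthogonality to N
    gives the slope - N_i / N_3. *)
Lemma height_derivative u i : cimg c u ->
  derivable (fun t => X (cinv c t) 0 2) u (e i) /\
  'D_(e i) (fun t => X (cinv c t) 0 2) u =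
    - N (cinv c u) 0 (widen_ord (isT : (2 <= 3)%N) i) / N (cinv c u) 0 2.
Proof.
move=> cu; have [sX _ cX cN tX] := spec.
have [dX _] := sX 1.
have dXu : derivable (X \o cinv c) u (e i) by apply: diff_derivable; exact: dX.
split; first by move/derivable_mxP : (dXu); apply.
have := tX u (e i) cu; rewrite dot3E !(derive_coord _ _ dXu) /=.
have D0 : 'D_(e i) (fun t => X (cinv c t) 0 0) u = (e i) 0 0.
  rewrite (near_eq_derive (g := fun t : 'rV[R]_2 => t 0 0)); last first.
    by apply: filterS (near_in oc cu) => t /cX [].
  by rewrite -(derive_coord (F := id)) ?derive_id//; exact: derivable_id.
have D1 : 'D_(e i) (fun t => X (cinv c t) 0 1) u = (e i) 0 1.
  rewrite (near_eq_derive (g := fun t : 'rV[R]_2 => t 0 1)); last first.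
    by apply: filterS (near_in oc cu) => t /cX [].
  by rewrite -(derive_coord (F := id)) ?derive_id//; exact: derivable_id.
rewrite -/X -/N D0 D1.
have N2 : N (cinv c u) 0 2 != 0 by exact: cN.
move: (N (cinv c u)) N2 => w N2 E; apply: (mulIf N2); rewrite (divfK N2).
apply/eqP; rewrite -addr_eq0; apply/eqP; rewrite -[RHS]E addrC; congr (_ + _).
case: i {dXu D0 D1 E} => -[|[|//]] i;
  rewrite /e !mxE /= ?mul1r ?mul0r ?addr0 ?add0r.
- by congr (w _ _); exact: val_inj.
- by congr (w _ _); exact: val_inj.
Qed.

Lemma slope_derivable u i j : cimg c u ->
  derivable (fun t => - N (cinv c t) 0 j / N (cinv c t) 0 2) u (e i).
Proof.
move=> cu; have [_ sN _ cN _] := spec.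
have CN l : Ck 1 (cimg c) (fun t => N (cinv c t) 0 l) by exact: Ck_coord (sN 1).
have C1 : Ck 1 (cimg c) ((fun=> - 1) \* (fun t => N (cinv c t) 0 j)
    \* (fun t => (N (cinv c t) 0 2)^-1)).
  by apply: CkM => //; [apply: CkM => //; exact: Ck_cst|exact: CkV].
have [d1 _] := C1.
have := @diff_derivable _ _ _ _ _ (e i) (d1 u cu).
by rewrite (_ : _ \* _ = fun t => - N (cinv c t) 0 j / N (cinv c t) 0 2)//;
  apply/funext => t /=; rewrite mulN1r.
Qed.

Variables (m kappa eps : R).
Hypotheses (m0 : 0 < m) (kappa0 : kappa != 0) (rm : 2 * r <= eps * m).
Hypothesis rotN : forall t z, `|t| < eps -> cimg c z ->
  cimg c (z - (t * m) *: delta_mx 0 1) ->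
  let w := N (cinv c z) in
  N (cinv c (z - (t * m) *: delta_mx 0 1)) =
    vec3 (cos (kappa * t) * w 0 0 - sin (kappa * t) * w 0 1)
         (sin (kappa * t) * w 0 0 + cos (kappa * t) * w 0 1) (w 0 2).

Lemma rotating_graph : let k := kappa / m in
  exists a b h : R, forall u, cimg c u ->
    let E := expR (k * (u 0 0 - z0 0 0)) in let s := k * (u 0 1 - z0 0 1) in
    [/\ X (cinv c u) 0 2 = h + E * (cos s * a + sin s * b) / k,
        N (cinv c u) 0 0 = - N (cinv c u) 0 2 * (E * (cos s * a + sin s * b)) &
        N (cinv c u) 0 1 = - N (cinv c u) 0 2 * (E * (cos s * b - sin s * a))].
Proof.
move=> k; have k0 : k != 0 by rewrite mulf_neq0// invr_neq0// gt_eqF.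
have [sX sN cX cN tX] := spec.
have b0r : `|b0 - b0| < r by rewrite subrr normr0.
have df a b : `|a - a0| < r -> `|b - b0| < r ->
    is_derive a (1 : R) (f^~ b) (P a b) /\ is_derive b (1 : R) (f a) (S a b).
  move=> ar br; have cab := ball_vec2 ar br; split.
    rewrite (_ : f^~ b = fun t => X (cinv c (vec2 0 b + t *: e 0)) 0 2); last first.
      by apply/funext => t; rewrite -line0.
    have [] := height_derivative 0 cab; rewrite [vec2 a b]line0 => d D.
    apply: is_derive_eq (is_derive_line d) _; rewrite D -line0 /P.
    by congr (- N _ _ _ / _); exact: val_inj.
  rewrite (_ : f a = fun t => X (cinv c (vec2 a 0 + t *: e 1)) 0 2); last first.
    by apply/funext => t; rewrite -line1.
  have [] := height_derivative 1 cab; rewrite [vec2 a b]line1 => d D.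
  apply: is_derive_eq (is_derive_line d) _; rewrite D -line1 /S.
  by congr (- N _ _ _ / _); exact: val_inj.
have dPS a : `|a - a0| < r ->
    derivable (P^~ b0) a (1 : R) /\ derivable (S^~ b0) a (1 : R).
  move=> ar; have cab := ball_vec2 ar b0r; rewrite line0 in cab; split.
    rewrite (_ : P^~ b0 = fun t => - N (cinv c (vec2 0 b0 + t *: e 0)) 0 0 /
        N (cinv c (vec2 0 b0 + t *: e 0)) 0 2); last first.
      by apply/funext => t; rewrite -line0.
    by have [] := is_derive_line (@slope_derivable _ 0 0 cab).
  rewrite (_ : S^~ b0 = fun t => - N (cinv c (vec2 0 b0 + t *: e 0)) 0 1 /
      N (cinv c (vec2 0 b0 + t *: e 0)) 0 2); last first.
    by apply/funext => t; rewrite -line0.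
  by have [] := is_derive_line (@slope_derivable _ 0 1 cab).
have rot a b : `|a - a0| < r -> `|b - b0| < r ->
    P a b = cos (k * (b - b0)) * P a b0 + sin (k * (b - b0)) * S a b0 /\
    S a b = cos (k * (b - b0)) * S a b0 - sin (k * (b - b0)) * P a b0.
  (* The time [t] carries the line b0 to the line b. The flow fixes N_3 and rotates (N_1, N_2), so
     it rotates the slopes by the same angle kappa t = - k (b - b0). *)
  move=> ar br; have cab := ball_vec2 ar br; have cab0 := ball_vec2 ar b0r.
  pose t := - (b - b0) / m.
  have E : vec2 a b = vec2 a b0 - (t * m) *: delta_mx 0 1.
    rewrite /t divfK ?gt_eqF//; apply: row2P; rewrite !mxE /=; ring.
  have te : `|t| < eps.
    rewrite /t normrM normrN normfV (gtr0_norm m0) ltr_pdivrMr//.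
    by apply: lt_le_trans br _; move: rm r0; lra.
  have := rotN te cab0; rewrite -E => /(_ cab) /=.
  have -> : kappa * t = - (k * (b - b0)) by rewrite /t /k; ring.
  rewrite sinN cosN => NE; rewrite /P /S NE !vec3E.
  have := cN _ cab0; rewrite -/N => N2.
  by split; field.
have [a [b [h sol]]] := rotating_gradient k0 r0 df dPS rot.
exists a, b, h => u cu; have [ur0 ur1 uE] := vec2_ball cu.
have [fE PE SE] := sol _ _ ur0 ur1.
have := cN _ cu; rewrite -/N => N2.
rewrite /f uE in fE; rewrite /P uE in PE; rewrite /S uE in SE.
split; [exact: fE|rewrite -PE|rewrite -SE].
  by field.
by field.
Qed.

End RotatingGraph.

(** * Quasi-rotational Gauss maps *)

(** The angle is acos (a / rho), with its sign changed when b is negative. *)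
Lemma polar_form (R : realType) (a b : R) : a ^+ 2 + b ^+ 2 != 0 ->
  exists rho theta : R, [/\ 0 < rho, a = rho * cos theta & b = rho * sin theta].
Proof.
move=> ab0; have ab : 0 < a ^+ 2 + b ^+ 2 by rewrite lt_def ab0 addr_ge0 ?sqr_ge0.
pose rho := Num.sqrt (a ^+ 2 + b ^+ 2).
have rho0 : 0 < rho by rewrite sqrtr_gt0.
have rhoE : rho ^+ 2 = a ^+ 2 + b ^+ 2 by rewrite sqr_sqrtr// ltW.
have ar : -1 <= a / rho <= 1.
  rewrite -ler_norml normrM normfV (gtr0_norm rho0) ler_pdivrMr// mul1r.
  rewrite -(gtr0_norm rho0) -ler_sqr ?nnegrE// !real_normK ?num_real//.
  by rewrite rhoE lerDl sqr_ge0.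
have c0 : cos (acos (a / rho)) = a / rho by rewrite acosK// in_itv.
have s0 : sin (acos (a / rho)) = `|b| / rho.
  rewrite sin_acos// (_ : 1 - _ = (b / rho) ^+ 2).
    by rewrite sqrtr_sqr normrM normfV (gtr0_norm rho0).
  rewrite !exprMn exprVn rhoE; by field.
have rn0 : rho != 0 by rewrite gt_eqF.
exists rho; have [b0|b0] := lerP 0 b.
  exists (acos (a / rho)); rewrite c0 s0 ger0_norm//.
  by split=> //; rewrite mulrC divfK.
exists (- acos (a / rho)); rewrite cosN sinN c0 s0 ltr0_norm// mulNr opprK.
by split=> //; rewrite mulrC divfK.
Qed.

Section QuasiRotational.
Context {R : realType} {M : topologicalType} (A : set (chart R M)).
Variables (x n : M -> 'rV[R]_3) (K : M -> R).
Hypotheses (hM : smooth_surface A) (hconn : connected [set: M])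
  (hx : immersion A x) (hn : gauss_map A x n) (hK : gaussian_curvature A x n K)
  (hgrad : forall O : set M, open O -> O !=set0 ->
     ~ (forall p, O p -> gradient_vanishes A x K p)).
Variables (e f : 'rV[R]_3) (m kappa : R) (phi : R -> M -> M).
Hypotheses (e1 : dot e e = 1) (f1 : dot f f = 1) (fe : dot f e = 0)
  (kappa0 : kappa != 0).

Let Q := frame_mx e f.
Let X := in_frame Q x.
Let N := in_frame Q n.

Hypotheses (phi0 : forall p, phi 0 p = p)
  (phic : continuous (fun q : R^o * M => phi q.1 q.2))
  (phiX : forall t p, X (phi t p) 0 0 = X p 0 0 /\ X (phi t p) 0 1 = X p 0 1 - t * m)
  (phiN : forall t p, N (phi t p) =
    vec3 (cos (kappa * t) * N p 0 0 - sin (kappa * t) * N p 0 1)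
         (sin (kappa * t) * N p 0 0 + cos (kappa * t) * N p 0 1) (N p 0 2)).

Let QQ : Q *m Q^T = 1%:M. Proof. exact: frame_mx_orthogonal. Qed.

Let chartA c : A c -> smooth_chart A c. Proof. by case: hM => _ _ _; apply. Qed.

Lemma normal_heightE p : N p 0 2 = dot (n p) e.
Proof. by rewrite /N /in_frame mul_frame_mx vec3E. Qed.

Lemma unit_normal p : N p 0 0 ^+ 2 + N p 0 1 ^+ 2 + N p 0 2 ^+ 2 = 1.
Proof.
have [_ n1 _] := hn; have := n1 p; rewrite -(dot_orthogonal _ _ QQ) dot3E.
by rewrite -!expr2.
Qed.

(** Density of the points where the surface is locally a graph; otherwise K would have zero gradient
    on O. *)
Lemma normal_not_equatorial (O : set M) : open O -> O !=set0 ->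
  exists2 p, O p & N p 0 2 != 0.
Proof.
move=> oO O0; apply: contrapT => nN; apply: (hgrad oO O0).
apply: (equatorial_gradient_vanishes hM hx hn hK oO e1) => p Op.
rewrite -normal_heightE; apply: contrapT => /eqP N2; apply: nN.
by exists p.
Qed.

Lemma normal_not_polar (O : set M) : open O -> O !=set0 ->
  ~ (forall p, O p -> N p 0 0 = 0 /\ N p 0 1 = 0).
Proof.
move=> oO O0 N0; apply: (hgrad oO O0).
apply: (polar_gradient_vanishes hM hx hn hK oO (e := e)) => p /N0 [N00 N01].
have NE : N p = dot (n p) e *: e *m Q^T.
  rewrite -scalemxAl mul_frame_mx e1 !(dotC e) dot_crossr fe.
  by apply: row3P; rewrite N00 N01 normal_heightE !vec3Z !vec3E !mulr0 mulr1.
rewrite -[LHS]mulmx1 -(mulmx1C QQ) mulmxA -/(in_frame Q n p) -/(N p) NE.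
by rewrite -mulmxA (mulmx1C QQ) mulmx1.
Qed.

(** If m = 0, the flow fixes the points of a box chart for short times, so a nontrivial rotation
    about e fixes n there and n is polar on an open set. *)
Lemma translation_neq0 : M -> m <> 0.
Proof.
move=> p1 m0.
have [|p _ N2] := normal_not_equatorial openT; first by exists p1.
have [c [r [eps [sc cp spec [r0 eps0 _ cball phiE]]]]] :=
  box_chart hM hx hn QQ phic phi0 phiX N2.
have [[od oi fi di fK iK cf ci] _] := sc.
apply: (normal_not_polar od); first by exists p.
move=> q cq.
have [t [t0 teps st]] := sin_neq0_near0 kappa0 eps0.
have qE : phi t q = q.
  have tn : `|t| < eps by rewrite gtr0_norm.
  have := phiE t (cfun c q) tn (fi _ cq).
  by rewrite m0 mulr0 scale0r subr0 fK//; apply; exact: fi.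
have := phiN t q; rewrite qE.
move: st; set C := cos _; set S := sin _ => S0 NE.
have E0 : N q 0 0 = C * N q 0 0 - S * N q 0 1 by rewrite {1}NE vec3E.
have E1 : N q 0 1 = S * N q 0 0 + C * N q 0 1 by rewrite {1}NE vec3E.
move: (N q 0 0) (N q 0 1) E0 E1 => y0 y1 E0 E1.
(* Determinant of the identity minus the rotation; the next two identities solve the linear system
   by its adjugate. *)
have D : 0 < (1 - C) ^+ 2 + S ^+ 2.
  by rewrite ltr_wpDl ?sqr_ge0// lt_def sqr_ge0 sqrf_eq0 S0.
have H0 : ((1 - C) ^+ 2 + S ^+ 2) * y0 = 0.
  transitivity ((1 - C) * (y0 - (C * y0 - S * y1)) - S * (y1 - (S * y0 + C * y1))).
    by ring.
  by rewrite -E0 -E1 !subrr !mulr0 subr0.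
have H1 : ((1 - C) ^+ 2 + S ^+ 2) * y1 = 0.
  transitivity ((1 - C) * (y1 - (S * y0 + C * y1)) + S * (y0 - (C * y0 - S * y1))).
    by ring.
  by rewrite -E0 -E1 !subrr !mulr0 addr0.
move/eqP : H0; rewrite mulf_eq0 gt_eqF//= => /eqP.
by move/eqP : H1; rewrite mulf_eq0 gt_eqF//= => /eqP.
Qed.

Hypothesis m0 : 0 < m.
Let k := kappa / m.

Let k0 : k != 0. Proof. by rewrite mulf_neq0// invr_neq0// gt_eqF. Qed.

(** Combines [box_chart] with [rotating_graph]. If a = b = 0 the slopes vanish and n is polar on the
    chart domain, which is excluded. *)
Lemma local_graph p : N p 0 2 != 0 ->
  exists (c : chart R M) (z : 'rV[R]_2) (a b h : R),
  [/\ smooth_chart A c, cdom c p, a ^+ 2 + b ^+ 2 != 0 &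
  forall u, cimg c u ->
    let E := expR (k * (u 0 0 - z 0 0)) in let s := k * (u 0 1 - z 0 1) in
    [/\ X (cinv c u) = vec3 (u 0 0) (u 0 1) (h + E * (cos s * a + sin s * b) / k),
        N (cinv c u) 0 2 != 0,
        N (cinv c u) 0 0 = - N (cinv c u) 0 2 * (E * (cos s * a + sin s * b)) &
        N (cinv c u) 0 1 = - N (cinv c u) 0 2 * (E * (cos s * b - sin s * a))]].
Proof.
move=> N2.
have [c [r [eps [sc cp spec [r0 eps0 reps cball phiE]]]]] :=
  box_chart hM hx hn QQ phic phi0 phiX N2.
have [t z teps cz cz'|a [b [h sol]]] :=
    rotating_graph r0 spec cball m0 kappa0 (reps m0).
  by rewrite -phiE//; exact: phiN.
have [[od oi fi di fK iK cf ci] _] := sc.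
have [_ _ cX cN _] := spec.
exists c, (cfun c p), a, b, h; split => //.
- apply/negP => /eqP ab0; apply: (normal_not_polar od); first by exists p.
  have a0 : a = 0.
    apply/eqP; rewrite -sqrf_eq0; apply/eqP.
    by move: ab0; have := sqr_ge0 a; have := sqr_ge0 b; lra.
  have b0 : b = 0.
    apply/eqP; rewrite -sqrf_eq0; apply/eqP.
    by move: ab0; have := sqr_ge0 a; have := sqr_ge0 b; lra.
  move=> q cq; have [_] := sol _ (fi _ cq).
  rewrite fK// a0 b0 !mulr0 addr0 subr0 !mulr0.
  by split.
- move=> u cu /=; have [X2 N0 N1] := sol u cu; have [X0 X1] := cX u cu.
  split=> //; last exact: cN.
  by apply: row3P; rewrite !vec3E.
Qed.

Lemma smooth_continuous y : smooth_map A y -> continuous (in_frame Q y).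
Proof.
move=> sy p; have [_ _ cov _] := hM; have [c Ac cp] := cov p.
have [[od oi fi di fK iK cf ci] _] := chartA Ac.
have cyf : {for p, continuous ((in_frame Q y \o cinv c) \o cfun c)}.
  apply: continuous_comp; first exact: cf.
  exact: (Ck_continuous (smooth_in_frame hM Q Ac sy 0) (fi _ cp)).
rewrite /prop_for /continuous_at /= fK// in cyf.
apply: cvg_trans cyf; apply: near_eq_cvg.
by apply: filterS (near_in od cp) => q cq /=; rewrite fK.
Qed.

Lemma normal_nowhere_equatorial p : N p 0 2 != 0.
Proof.
have [|p1 _ N21] := normal_not_equatorial openT; first by exists p.
pose G q := 1 - N q 0 2 ^+ 2.
pose H q := N q 0 2 ^+ 2 * expR (2 * k * X q 0 0).
pose C1 := G p1 / H p1.
have H1 : H p1 != 0 by rewrite mulf_neq0 ?expf_neq0// gt_eqF// expR_gt0.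
(* The horizontal part of N is - N_3 E times (a, b) turned by an angle, so its squared length is
   (a^2 + b^2) N_3^2 E^2; [D] absorbs the base point of the exponential. *)
have loc q : N q 0 2 != 0 -> exists O D, [/\ open O, O q &
    forall q', O q' -> G q' = D * H q'].
  move=> N2; have [c [z [a [b [h [sc cq ab sol]]]]]] := local_graph N2.
  have [[od oi fi di fK iK cf ci] _] := sc.
  exists (cdom c), ((a ^+ 2 + b ^+ 2) * expR (- (2 * k * z 0 0))); split => //.
  move=> q' cq'; have [XE _ N0 N1] := sol _ (fi _ cq').
  rewrite fK// in XE N0 N1.
  have X0 : X q' 0 0 = cfun c q' 0 0 by rewrite XE vec3E.
  have -> : G q' = N q' 0 0 ^+ 2 + N q' 0 1 ^+ 2.
    by rewrite /G -(unit_normal q') addrK.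
  rewrite /H N0 N1 X0.
  set u := cfun c q' 0 0; set s := k * (cfun c q' 0 1 - z 0 1).
  rewrite [RHS](_ : _ = (a ^+ 2 + b ^+ 2) * N q' 0 2 ^+ 2 *
     (expR (- (2 * k * z 0 0)) * expR (2 * k * u))); last by ring.
  rewrite -expRD.
  rewrite (_ : _ + 2 * k * u = k * (u - z 0 0) + k * (u - z 0 0)).
    rewrite expRD; set E := expR _.
    transitivity ((cos s ^+ 2 + sin s ^+ 2) *
      ((a ^+ 2 + b ^+ 2) * N q' 0 2 ^+ 2 * (E * E))).
      by ring.
    by rewrite cos2Dsin2 mul1r.
  by ring.
pose F q := G q - C1 * H q.
have N2c : continuous (fun q => N q 0 2).
  move=> q; apply: (@continuous_comp _ _ _ N (fun v : 'rV[R]_3 => v 0 2)).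
    by apply: smooth_continuous; case: hn.
  exact: coord_continuous.
have X0c : continuous (fun q => X q 0 0).
  move=> q; apply: (@continuous_comp _ _ _ X (fun v : 'rV[R]_3 => v 0 0)).
    by apply: smooth_continuous; case: hx.
  exact: coord_continuous.
have Fc : continuous F.
  move=> q; have N22 : {for q, continuous (fun q => N q 0 2 ^+ 2)}.
    by apply: continuousM; exact: N2c.
  apply: continuousB; first by apply: continuousB => //; exact: cst_continuous.
  apply: continuousM; first exact: cst_continuous.
  apply: continuousM => //.
  apply: continuous_comp; last exact: continuous_expR.
  by apply: continuousM; [exact: cst_continuous|exact: X0c].
(* The locus where G = C1 H with the constant of [p1]. On it N_3 = 0 would give 1 = 0, and near each
   of its points the local constant [D] must equal [C1]. *)
pose S := F @^-1` [set y | y = 0].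
have Sp1 : S p1 by rewrite /S /= /F /C1 divfK// subrr.
have S2 q : S q -> N q 0 2 != 0.
  rewrite /S /= /F /G /H; have [->|//] := eqVneq (N q 0 2) 0.
  by rewrite expr0n mul0r mulr0 !subr0 => /eqP; rewrite oner_eq0.
have cS : closed S.
  by apply: preimage_closed; [move=> q _; exact: Fc|exact: closed_eq].
have oS : open S.
  rewrite openE => q Sq; have [B [D [oB Bq GD]]] := loc _ (S2 _ Sq).
  have Hq : H q != 0 by rewrite mulf_neq0 ?expf_neq0 ?S2// gt_eqF// expR_gt0.
  have DC : D = C1.
    apply: (mulIf Hq); rewrite -GD//; apply/eqP; rewrite -subr_eq0; apply/eqP.
    exact: Sq.
  apply: filterS (near_in oB Bq) => q' Bq'.
  by rewrite /S /= /F GD// DC subrr.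
have ST : S = setT.
  by apply: hconn; [exists p1|exists S; rewrite ?setTI|exists S; rewrite ?setTI].
by apply: S2; rewrite ST.
Qed.

(** Amplitude 1 suffices: a factor rho in front of the exponential is a translation in the first
    parameter, and a phase is one in the second. *)
Lemma locally_congruent_p_surface : locally_congruent A x (p_surface k 1).
Proof.
move=> p.
have [c [z [a [b [h [sc cp ab sol]]]]]] :=
  local_graph (normal_nowhere_equatorial p).
have [[od oi fi di fK iK cf ci] _] := sc.
have [rho [th [rho0 aE bE]]] : exists rho th, [/\ 0 < rho,
    a / k = rho * cos th & b / k = rho * sin th].
  apply: polar_form; rewrite !exprMn -mulrDl mulf_neq0//.
  by rewrite expf_neq0// invr_neq0.
(* The shift - ln rho / k normalizes the amplitude and th / k removes the phase; z is the base point
   of the local formula. *)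
pose w : 'rV[R]_2 := \row_(i < 2) [:: z 0 0 - ln rho / k; z 0 1 + th / k]`_i.
have w0 : w 0 0 = z 0 0 - ln rho / k by rewrite mxE.
have w1 : w 0 1 = z 0 1 + th / k by rewrite mxE.
pose V : set 'rV[R]_2 := (fun u => u + w) @^-1` cimg c.
have sD (U : set 'rV[R]_2) y : open U -> smooth_on U (fun u : 'rV[R]_2 => u + y).
  by move=> oU j; apply: (CkD oU (Ck_id _ _) (Ck_cst _ _ y)).
have oV : open V.
  have := open_setI_preimage openT (sD setT w openT 0) oi.
  by rewrite setTI.
exists (reparam_chart c (cimg c) V (fun u => u - w) (fun u => u + w)),
  (fun q => q *m Q + vec3 (w 0 0) (w 0 1) h *m Q); split.
- apply: smooth_reparam_chart => //.
  + by move=> u cu; rewrite /V /= subrK.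
  + by move=> u _; rewrite subrK.
  + by move=> u _; rewrite addrK.
  + exact: sD.
  + exact: sD.
- by split=> //=; exact: fi.
- by exists Q, (vec3 (w 0 0) (w 0 1) h *m Q); split=> //; exact: det_frame_mx.
move=> u Vu /=; have [XE _ _ _] := sol _ Vu.
rewrite -[LHS]mulmx1 -(mulmx1C QQ) mulmxA -mulmxDl; congr (_ *m Q).
rewrite -/(in_frame Q x _) -/X XE; apply: row3P.
rewrite /p_surface !vec3E mul1r.
have D0 : (u + w) 0 0 = u 0 0 + w 0 0 by rewrite mxE.
have D1 : (u + w) 0 1 = u 0 1 + w 0 1 by rewrite mxE.
rewrite D0 D1 vec3D !vec3E; split => //.
rewrite addrC; congr (_ + _).
rewrite w0 w1.
have -> : k * (u 0 0 + (z 0 0 - ln rho / k) - z 0 0) = k * u 0 0 - ln rho by field.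
have -> : k * (u 0 1 + (z 0 1 + th / k) - z 0 1) = k * u 0 1 + th by field.
set s := _ + th.
have rn0 : rho != 0 by rewrite gt_eqF.
rewrite expRD expRN lnK ?posrE// (_ : _ / k = expR (k * u 0 0) / rho *
    (cos s * (a / k) + sin s * (b / k))); last by field; rewrite ?rn0 ?k0.
rewrite aE bE (_ : k * u 0 1 = s - th); last by rewrite /s addrK.
by rewrite cosB; field; rewrite ?rn0 ?k0.
Qed.

End QuasiRotational.

Theorem theorem3p4 (R : realType) (M : topologicalType) (A : set (chart R M))
    (x n : M -> 'rV[R]_3) (K : M -> R)
    (hM : smooth_surface A) (hconn : connected [set: M])
    (hx : immersion A x) (hn : gauss_map A x n)
    (hK : gaussian_curvature A x n K)
    (hgrad : forall O : set M, open O -> O !=set0 ->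
       ~ (forall p, O p -> gradient_vanishes A x K p))
    (hqr : strictly_quasi_rotational A x n) :
  exists k c : R,
    [/\ k != 0, c != 0 & locally_congruent A x (p_surface k c)].
Proof.
have [l [P [v [phi [kappa [[vP [phi0 _ phic _] lP proj rot] kappa0]]]]]] := hqr.
pose e := line_dir l; have e1 : dot e e = 1 by exact: line_dir_unit.
have [c pE] := orthogonal_line_planeP lP; rewrite -/e in pE.
have c0 : c != 0.
  apply/eqP => c0; have := plane_normal_unit P.
  by rewrite pE c0 dotZl mul0r => /esym/eqP; rewrite oner_eq0.
have ve : dot v e = 0.
  move: vP; rewrite /parallel_to_plane pE dotC dotZl dotC => /eqP.
  by rewrite mulf_eq0 (negbTE c0) => /eqP.
have [f [m [f1 fe m0 vE]]] := unit_normal_direction e1 ve.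
pose Q := frame_mx e f.
(* Pairing the translation law with g orthogonal to e eliminates the projection onto P; it is used
   for g = f x e and g = f. *)
have flow t p g : dot g e = 0 ->
    dot (x (phi t p)) g = dot (x p) g - t * m * dot f g.
  move=> ge; have projg q : dot (plane_proj P q) g = dot q g.
    by rewrite /plane_proj pE dotDl -scaleNr !dotZl (dotC e) ge !mulr0 addr0.
  have := congr1 (fun y => dot y g) (proj t p).
  by rewrite dotDl !projg => ->; rewrite vE !dotZl; ring.
have phiX t p : in_frame Q x (phi t p) 0 0 = in_frame Q x p 0 0 /\
    in_frame Q x (phi t p) 0 1 = in_frame Q x p 0 1 - t * m.
  rewrite /in_frame !mul_frame_mx !vec3E !flow ?dot_crossr// f1 mulr1.
  by rewrite (dotC f) dot_crossl mulr0 subr0.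
have phiN t p : in_frame Q n (phi t p) =
    let w := in_frame Q n p in
    vec3 (cos (kappa * t) * w 0 0 - sin (kappa * t) * w 0 1)
         (sin (kappa * t) * w 0 0 + cos (kappa * t) * w 0 1) (w 0 2).
  rewrite /in_frame rot /rotation_linear -/e !mulmxDl -!scalemxAl frame_mx_cross//.
  rewrite !mul_frame_mx e1 !(dotC e) dot_crossr fe.
  rewrite !vec3Z !vec3D !vec3E.
  by congr vec3; ring.
(* On an empty M the conclusion is vacuous and any nonzero constants do. *)
have [p|noM] := pselect (exists p : M, True); last first.
  exists 1, 1; split; rewrite ?oner_neq0// => p.
  by exfalso; apply: noM; exists p.
have {}m0 : 0 < m.
  rewrite lt_def m0 andbT; apply/eqP.
  have [q _] := p.
  exact: (translation_neq0 hM hx hn hK hgrad e1 f1 fe kappa0 phi0 phic phiX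
    phiN q).
exists (kappa / m), 1; split; rewrite ?oner_neq0//.
  by rewrite mulf_neq0// invr_neq0// gt_eqF.
exact: (locally_congruent_p_surface hM hconn hx hn hK hgrad e1 f1 fe kappa0 phi0
  phic phiX phiN m0).
Qed.
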